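(* There exist sets $S$ of $7$ polyominoes such that $S$ can tile the plane with translated copies of its elements, but only non-periodically; that is, at least one tiling of the plane by translated copies of polyominoes in $S$ exists, and every such tiling is non-periodic.
   Context: A polyomino is a connected union of finitely many unit squares of the square grid glued together edge-to-edge; equivalently, it is a nonempty finite subset $P\subset\mathbb{Z}^2$ (each point standing for a unit cell) that is connected under the relation of two cells sharing an edge. Polyominoes are considered up to translation, so the elements of a set of $7$ polyominoes are pairwise not translates of one another. Tilings are translational: only translations are allowed, no rotations or reflections. A tiling of the plane by translated copies of $S=\{P_1,\dots,P_7\}$ is a tuple of sets $T_1,\dots,T_7\subseteq\mathbb{Z}^2$ (some possibly empty) such that every cell of $\mathbb{Z}^2$ belongs to exactly one of the translated copies $P_i+v$ with $1\le i\le 7$ and $v\in T_i$. In particular, not every polyomino of $S$ is required to be used. A tiling $(T_1,\dots,T_7)$ is periodic if there is a nonzero vector $u\in\mathbb{Z}^2$ with $T_i+u=T_i$ for all $i$, and non-periodic otherwise. *)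

(* Defs.v *)
From mathcomp Require Import all_boot all_order all_algebra.
From mathcomp Require Import finmap classical_sets.

Set Implicit Arguments.
Unset Strict Implicit.
Unset Printing Implicit Defensive.

Import GRing.Theory Num.Theory.
Local Open Scope ring_scope.
Local Open Scope classical_set_scope.

Notation cell := (int * int)%type.

Definition adjacent (x y : cell) : bool :=
  `|x.1 - y.1| + `|x.2 - y.2| == 1.

Definition polyomino (P : {fset cell}) : Prop :=
  P != fset0 /\
  forall x y : P, connect (fun a b : P => adjacent (val a) (val b)) x y.

Definition translate (v : cell) (A : set cell) : set cell :=
  [set a + v | a in A].

(* Polyominoes are identified up to translation, so a set of n of them is
   given by n representatives, no two of which are translates of each other. *)
Definition polyomino_set (n : nat) (P : 'I_n -> {fset cell}) : Prop :=
  (forall i, polyomino (P i)) /\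
  forall (i j : 'I_n) (v : cell), i != j ->
    [set` P i] <> translate v [set` P j].

(* The copies are indexed by pairs (i, v) with v in T i; some T i may be
   empty. *)
Definition tiling (n : nat) (P : 'I_n -> {fset cell}) (T : 'I_n -> set cell) :
    Prop :=
  forall c : cell, exists! iv : 'I_n * cell,
    T iv.1 iv.2 /\ translate iv.2 [set` P iv.1] c.

(* A single nonzero period suffices. *)
Definition periodic (n : nat) (T : 'I_n -> set cell) : Prop :=
  exists2 u : cell, u != 0 & forall i, translate u (T i) = T i.

(* Main.v *)
(* Bumps, dents and spurs force every tiling to consist of 12 x 12 macro cells
   on a grid, arranged in rows of constant kind in which rows of spacers (kind
   0) alternate with rows of strips. A strip has teeth reaching into the spacer
   rows above and below it: two below, and one (kind 1) or three (kind 2)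
   above; the rest of a spacer row is filled by horizontal dominoes. All teeth
   of a row of strips have the same parity, so in a spacer row the teeth from
   above and below alternate, and the strip rows on both sides have equally
   many there. Hence the density of top teeth is multiplied by 1/2 or 3/2 from
   one strip row to the next one above it: a vertical period would give 2 ^ k =
   n with n odd and k > 0, and for a horizontal one the number of top teeth per
   period would be divisible by every power of 2.

   For the existence of a tiling, start from mean distance 1 and iterate the
   bijection of [1, 3) given by a |-> a / 2 for a >= 2 and a |-> 3 * a / 2
   otherwise, in both directions. Strips placed at positions given by floor
   functions realise these distances, with teeth interleaving as needed. *)

Require Import Defs.
From mathcomp Require Import all_boot all_order all_algebra.
From mathcomp Require Import finmap classical_sets boolp zify ring lra.

Set Implicit Arguments.
Unset Strict Implicit.
Unset Printing Implicit Defensive.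

Import Order.TTheory GRing.Theory Num.Theory.
Local Open Scope ring_scope.

(** * Macro cells *)

(* The shape of a macro cell of kind k is the 12 x 12 square with bumps of
   length 5 on its right and upper sides and the matching dents on its left and
   lower sides. A spur beside each bump encodes a colour: the kind itself for
   the vertical sides, and whether the cell above is of kind 0 for the
   horizontal ones. Hence horizontal neighbours have equal kinds, and of two
   vertical neighbours exactly one is of kind 0. *)
Definition spacer (k : nat) : bool := k == 0%N.

Definition left_spur (k : nat) : int := if spacer k then 0 else k.+1%:Z.
Definition bottom_spur (c : bool) : int := if c then 2 else 0.

Definition left_dent (k : nat) (x y : int) : bool :=
  (0 <= x < 5) && (y == 7) || (x == left_spur k) && (y == 6).

Definition bottom_dent (c : bool) (x y : int) : bool :=
  (0 <= y < 5) && (x == 7) || (y == bottom_spur c) && (x == 6).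

Definition in_shape (k : nat) (p : cell) : bool :=
  [|| [&& 0 <= p.1 < 12, 0 <= p.2 < 12, ~~ left_dent k p.1 p.2
        & ~~ bottom_dent (spacer k) p.1 p.2],
      left_dent k (p.1 - 12) p.2 | bottom_dent (~~ spacer k) p.1 (p.2 - 12)].

Definition side : seq int := [seq i%:Z | i <- iota 0 17].
Definition box : seq cell := [seq (x, y) | x <- side, y <- side].
Definition shape (k : nat) : seq cell := [seq p <- box | in_shape k p].

Lemma mem_box (p : cell) : (p \in box) = (0 <= p.1 < 17) && (0 <= p.2 < 17).
Proof.
have side_mem x : (x \in side) = (0 <= x < 17).
  apply/mapP/idP=> [[i]|Hx].
    by rewrite mem_iota => Hi ->; lia.
  by exists `|x|%N; rewrite ?mem_iota; lia.
case: p => x y; apply/allpairsP/idP => [[[u v] /= [Hu Hv [-> ->]]]|/=].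
  by rewrite -!side_mem Hu Hv.
by rewrite -!side_mem => /andP[Hx Hy]; exists (x, y).
Qed.

Lemma kind_ind (Q : nat -> Prop) :
  Q 0%N -> Q 1%N -> Q 2%N -> forall k, (k < 3)%N -> Q k.
Proof. by move=> Q0 Q1 Q2 [|[|[|]]]. Qed.

Lemma in_shape_box (k : nat) (p : cell) : (k < 3)%N -> in_shape k p ->
  p \in box.
Proof.
rewrite mem_box; case: p => x y; elim/kind_ind: k /;
  rewrite /in_shape /left_dent /bottom_dent /left_spur /=; lia.
Qed.

Lemma mem_shape (k : nat) (p : cell) : (k < 3)%N ->
  (p \in shape k) = in_shape k p.
Proof.
move=> Hk; rewrite mem_filter; case H: (in_shape k p) => //=.
exact: in_shape_box H.
Qed.

(** Reduces a claim about all cells of the three shapes to a finite check that can be run by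
    computation. *)
Lemma shape_ind (Q : nat -> cell -> bool) :
  all (fun k => all (Q k) (shape k)) (iota 0 3) ->
  forall k p, (k < 3)%N -> in_shape k p -> Q k p.
Proof.
move=> /allP H k p Hk Hp; apply: (allP (H k _)); first by rewrite mem_iota.
by rewrite mem_shape.
Qed.

(* The dent of a placed macro cell can only be filled by the tip of a bump. *)
Lemma tip_right (k : nat) (p : cell) : (k < 3)%N -> in_shape k p ->
  ~~ in_shape k (p + (1, 0)) -> ~~ in_shape k (p + (0, 1)) ->
    ~~ in_shape k (p + (0, -1)) ->
  p = (16, 7).
Proof.
move=> Hk Hp H1 H2 H3; apply/eqP.
pose Q k p := [==> ~~ in_shape k (p + (1, 0)), ~~ in_shape k (p + (0, 1)),
  ~~ in_shape k (p + (0, -1)) => (p == (16, 7))].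
have : Q k p by apply: (@shape_ind Q _ k p Hk Hp); vm_compute.
by rewrite /Q H1 H2 H3.
Qed.

Lemma tip_up (k : nat) (p : cell) : (k < 3)%N -> in_shape k p ->
  ~~ in_shape k (p + (1, 0)) -> ~~ in_shape k (p + (-1, 0)) ->
    ~~ in_shape k (p + (0, 1)) ->
  p = (7, 16).
Proof.
move=> Hk Hp H1 H2 H3; apply/eqP.
pose Q k p := [==> ~~ in_shape k (p + (1, 0)), ~~ in_shape k (p + (-1, 0)),
  ~~ in_shape k (p + (0, 1)) => (p == (7, 16))].
have : Q k p by apply: (@shape_ind Q _ k p Hk Hp); vm_compute.
by rewrite /Q H1 H2 H3.
Qed.

(** The right, upper and lower neighbours of [(4, 7)], the inner end of the left dent, are taken, so
    whatever fills this cell from outside meets the hypotheses of [tip_right]. *)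
Lemma dent_left (k : nat) : (k < 3)%N ->
  [/\ ~~ in_shape k (4, 7), in_shape k (5, 7),
    in_shape k (4, 8) & in_shape k (4, 6)].
Proof. by elim/kind_ind: k /. Qed.

Lemma dent_down (k : nat) : (k < 3)%N ->
  [/\ ~~ in_shape k (7, 4), in_shape k (8, 4),
    in_shape k (6, 4) & in_shape k (7, 5)].
Proof. by elim/kind_ind: k /. Qed.

Lemma in_shape_square (k : nat) (x y : int) :
  5 <= x < 12 -> 5 <= y < 12 -> (k < 3)%N -> in_shape k (x, y).
Proof.
move=> Hx Hy; elim/kind_ind: k /;
  rewrite /in_shape /left_dent /bottom_dent /left_spur /bottom_spur /=; lia.
Qed.

(** Seen from the right-hand cell, of kind [k], the spur of a left neighbour of kind [k'] lies at
    [(left_spur k', 6)]. A dent receives it there only if the kinds agree; otherwise both cells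
    cover that place. *)
Lemma clash_right (k k' : nat) : (k < 3)%N -> (k' < 3)%N -> k != k' ->
  in_shape k (left_spur k', 6) /\ in_shape k' (left_spur k' + 12, 6).
Proof.
by move=> Hk Hk'; elim/kind_ind: k / Hk; elim/kind_ind: k' / Hk'.
Qed.

Lemma clash_up (k k' : nat) : (k < 3)%N -> (k' < 3)%N ->
  spacer k == spacer k' ->
  in_shape k (6, bottom_spur (~~ spacer k')) /\
    in_shape k' (6, bottom_spur (~~ spacer k') + 12).
Proof.
by move=> Hk Hk'; elim/kind_ind: k / Hk; elim/kind_ind: k' / Hk'.
Qed.

Definition fits (k : nat) (d : cell) (k' : nat) : bool :=
  [|| (d \in [:: (1, 0); (-1, 0)]) && (k == k'),
      (d \in [:: (0, 1); (0, -1)]) && (spacer k != spacer k')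
    | ~~ (d \in [:: (1, 0); (-1, 0); (0, 1); (0, -1)])].

Lemma fits_disjoint (k k' : nat) (p p' d : cell) :
  (k < 3)%N -> (k' < 3)%N -> in_shape k p -> in_shape k' p' ->
  p = (d.1 * 12, d.2 * 12) + p' -> d != 0 -> ~~ fits k d k'.
Proof.
move=> Hk Hk' Hp Hp' E d0.
have Hb := in_shape_box Hk Hp; have Hb' := in_shape_box Hk' Hp'.
pose ds : seq cell := [seq (x, y) | x <- [:: -1; 0; 1], y <- [:: -1; 0; 1]].
(* Shapes fit in a box of side 17 < 24, so macro cells more than one step apart cannot meet, and
   nine displacements remain to be checked. *)
have dd : d \in ds.
  move: Hb Hb' E; rewrite !mem_box; clear.
  case: d p p' => dx dy [x y] [x' y'] /= H H' [E1 E2].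
  have Hx : dx \in [:: -1; 0; 1] by rewrite !inE; lia.
  have Hy : dy \in [:: -1; 0; 1] by rewrite !inE; lia.
  by apply/allpairsP; exists (dx, dy).
pose Q k p := all (fun d : cell => all (fun k' =>
  [==> in_shape k' (p - (d.1 * 12, d.2 * 12)), d != 0 => ~~ fits k d k'])
  (iota 0 3)) ds.
have : Q k p by apply: (@shape_ind Q _ k p Hk Hp); vm_compute.
move/allP => /(_ d dd) /allP /(_ k').
by rewrite mem_iota E addrC addKr => /(_ Hk'); rewrite Hp' d0.
Qed.

(** Inside its square a shape lacks only the dents on its left and lower sides; these are filled by
    the left neighbour, of the same kind [k], and by the lower neighbour, of kind [kd]. *)
Lemma cover_square (k kd : nat) (p : cell) :
  (k < 3)%N -> (kd < 3)%N -> spacer kd != spacer k ->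
  0 <= p.1 < 12 -> 0 <= p.2 < 12 ->
  [|| in_shape k p, in_shape k (p + (12, 0)) | in_shape kd (p + (0, 12))].
Proof.
move=> Hk Hkd Hw Hx Hy.
have : p \in box by rewrite mem_box; lia.
pose Q k kd p := [==> spacer kd != spacer k, 0 <= p.1 < 12, 0 <= p.2 < 12 =>
  [|| in_shape k p, in_shape k (p + (12, 0)) | in_shape kd (p + (0, 12))]].
have /allP : all (Q k kd) box.
  by elim/kind_ind: k / Hk {Hw}; elim/kind_ind: kd / Hkd; vm_compute.
by move=> /(_ p) H /H; rewrite /Q Hw Hx Hy.
Qed.

(** * The seven polyominoes *)

(* Piece 0 is a horizontal domino of spacers. Piece i > 0 is a strip of 4 *
   piece_width i macro cells of kind 1 or 2, with spacers (the teeth) below the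
   positions 2 * u, u in bottoms i, and above the positions 2 * t, t in tops i.
   There are two teeth below, and one (kind 1) or three (kind 2) above. The
   positions are chosen so that compare_teeth holds. *)
Definition piece_width (i : nat) : nat := nth 0%N [:: 0; 2; 3; 3; 4; 5; 6]%N i.
Definition piece_kind (i : nat) : nat := nth 0%N [:: 0; 1; 1; 2; 2; 2; 2]%N i.
Definition bottoms (i : nat) : seq nat :=
  nth [::] [:: [::]; [:: 0; 3]; [:: 1; 4];
    [:: 1; 4]; [:: 1; 5]; [:: 3; 9]; [:: 5; 9]]%N i.
Definition tops (i : nat) : seq nat :=
  nth [::] [:: [::]; [:: 3]; [:: 5];
    [:: 1; 3; 5]; [:: 2; 4; 7]; [:: 2; 6; 9]; [:: 4; 8; 9]]%N i.

Definition patch (i : nat) : seq cell :=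
  if i == 0%N then [:: (0, 0); (1, 0)] else
  [seq (l%:Z, 1) | l <- iota 0 (4 * piece_width i)%N] ++
  [seq ((2 * u)%N%:Z, 0) | u <- bottoms i] ++
  [seq ((2 * t)%N%:Z, 2) | t <- tops i].

Definition patch_kind (i : nat) (u : cell) : nat :=
  if u.2 == 1 then piece_kind i else 0%N.

Definition scale (u : cell) : cell := (u.1 * 12, u.2 * 12).

Definition piece_cells (i : nat) : seq cell :=
  flatten [seq [seq scale u + p | p <- shape (patch_kind i u)] | u <- patch i].

Definition piece (i : 'I_7) : {fset cell} := [fset x | x in piece_cells i]%fset.

Ltac cell_lia :=
  repeat match goal with u : cell |- _ => destruct u as [? ?] end;
  rewrite /scale /=; congr pair => /=; lia.

Lemma scaleD (u v : cell) : scale (u + v) = scale u + scale v.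
Proof. by rewrite /scale /= !mulrDl. Qed.

Lemma scaleB (u v : cell) : scale (u - v) = scale u - scale v.
Proof. by rewrite /scale /= !mulrBl. Qed.

Lemma patch_kind_lt (i : nat) (u : cell) : (patch_kind i u < 3)%N.
Proof. by rewrite /patch_kind; case: ifP => // _;
  case: i => [|[|[|[|[|[|[|[]]]]]]]]. Qed.

Lemma piece_cellsP (i : nat) (c : cell) :
  reflect (exists2 u, u \in patch i & in_shape (patch_kind i u) (c - scale u))
          (c \in piece_cells i).
Proof.
apply: (iffP flatten_mapP) => [[u Hu /mapP[p Hp ->]]|[u Hu Hp]].
  by exists u; rewrite // addrC addKr -mem_shape ?patch_kind_lt.
exists u => //; apply/mapP; exists (c - scale u);
  first by rewrite mem_shape ?patch_kind_lt.
by rewrite addrC subrK.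
Qed.

Lemma mem_piece (i : 'I_7) (c : cell) : (c \in piece i) = (c \in piece_cells i).
Proof. by rewrite !inE. Qed.

Lemma patch_fits (i : nat) (u u' : cell) : (i < 7)%N ->
  u \in patch i -> u' \in patch i -> u' != u ->
    fits (patch_kind i u) (u' - u) (patch_kind i u').
Proof.
pose Q i := all (fun u => all (fun u' =>
  (u' != u) ==> fits (patch_kind i u) (u' - u) (patch_kind i u')) (patch i))
    (patch i).
have HQ : all Q (iota 0 7) by vm_compute.
move=> Hi Hu Hu' Hn; have /(allP HQ) : i \in iota 0 7 by rewrite mem_iota.
by move=> /allP /(_ u Hu) /allP /(_ u' Hu'); rewrite Hn.
Qed.

Lemma fits_overlap (a a' c : cell) (k k' : nat) (d : cell) :
  (k < 3)%N -> (k' < 3)%N -> in_shape k (c - a) -> in_shape k' (c - a') ->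
  a' = a + scale d -> d != 0 -> ~~ fits k d k'.
Proof.
move=> Hk Hk' Hc Hc' E; apply: fits_disjoint Hk Hk' Hc Hc' _.
by rewrite E; clear; cell_lia.
Qed.

(** * Every tiling is aligned to a grid of macro cells *)

Section Rigidity.

Variable T : 'I_7 -> set cell.
Hypothesis tilT : tiling piece T.

(** Uniqueness in the tiling settles the copy [(i, v)]; within one copy, [patch_fits] keeps distinct
    macro cells disjoint. *)
Lemma owner_uniq (c v v' u u' : cell) (i i' : 'I_7) :
  T i v -> u \in patch i -> in_shape (patch_kind i u) (c - (v + scale u)) ->
  T i' v' -> u' \in patch i' ->
    in_shape (patch_kind i' u') (c - (v' + scale u')) ->
  [/\ i = i', v = v' & u = u'].
Proof.
move=> Ti Hu Hc Ti' Hu' Hc'.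
have trans (j : 'I_7) (w x : cell) : x \in patch j ->
  in_shape (patch_kind j x) (c - (w + scale x)) ->
    translate w [set` piece j] c.
  move=> Hx Hi; exists (c - w); last by rewrite subrK.
  rewrite /= mem_piece; apply/piece_cellsP; exists x => //.
  by rewrite -addrA -opprD.
have [[j w] [_ H]] := tilT c.
have E1 := H (i, v) (conj Ti (trans _ _ _ Hu Hc)).
have E2 := H (i', v') (conj Ti' (trans _ _ _ Hu' Hc')).
have [Ei Ev] : (i, v) = (i', v') by rewrite -E1 -E2.
subst i' v'; split=> //; apply/eqP/contraT => Hn.
have := @fits_overlap (v + scale u) (v + scale u') c _ _ (u' - u)
  (patch_kind_lt i u) (patch_kind_lt i u') Hc Hc'.
have -> : v + scale u' = v + scale u + scale (u' - u) by clear; cell_lia.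
move=> /(_ erefl); rewrite subr_eq0 eq_sym Hn => /(_ isT).
by rewrite patch_fits // eq_sym.
Qed.

(** Forgets the piece, so that the alignment argument deals with single macro cells only. *)
Definition placed (a : cell) (k : nat) : Prop :=
  exists (i : 'I_7) (v u : cell),
    [/\ T i v, u \in patch i, k = patch_kind i u & a = v + scale u].

Lemma placed_lt (a : cell) (k : nat) : placed a k -> (k < 3)%N.
Proof. by move=> [i [v [u [_ _ -> _]]]]; apply: patch_kind_lt. Qed.

Lemma placed_uniq (c a a' : cell) (k k' : nat) :
  placed a k -> placed a' k' -> in_shape k (c - a) -> in_shape k' (c - a') ->
    a = a'.
Proof.
move=> [i [v [u [Ti Hu -> ->]]]] [i' [v' [u' [Ti' Hu' -> ->]]]] H H'.
by have [_ -> ->] := owner_uniq Ti Hu H Ti' Hu' H'.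
Qed.

Lemma placed_fun (a : cell) (k k' : nat) : placed a k -> placed a k' -> k = k'.
Proof.
move=> Ha Ha'; have Hk := placed_lt Ha; have Hk' := placed_lt Ha'.
have mid : (a + (5, 5)) - a = (5, 5) by clear; cell_lia.
have H : in_shape k (a + (5, 5) - a) by rewrite mid in_shape_square.
have H' : in_shape k' (a + (5, 5) - a) by rewrite mid in_shape_square.
move: Ha Ha' H H' => [i [v [u [Ti Hu -> E]]]] [i' [v' [u' [Ti' Hu' -> E']]]].
move=> H H'.
have H1 : in_shape (patch_kind i u) (a + (5, 5) - (v + scale u)) by rewrite -E.
have H1' : in_shape (patch_kind i' u') (a + (5, 5) - (v' + scale u'))
  by rewrite -E'.
by have [-> _ ->] := owner_uniq Ti Hu H1 Ti' Hu' H1'.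
Qed.

Lemma placed_cover (c : cell) : exists a k, placed a k /\ in_shape k (c - a).
Proof.
have [[i v] [[/= Ti [x Hx E]] _]] := tilT c.
move: Hx; rewrite /= mem_piece => /piece_cellsP[u Hu Hi].
exists (v + scale u), (patch_kind i u); split; first by exists i, v, u.
by move: Hi; rewrite -E opprD addrA addrK.
Qed.

Lemma placed_fits (a d : cell) (k k' : nat) :
  placed a k -> placed (a + scale d) k' -> d != 0 -> fits k d k'.
Proof.
move=> Ha Ha' d0; have Hk := placed_lt Ha; have Hk' := placed_lt Ha'.
have clash x y : in_shape k (x, y) ->
  in_shape k' (x - d.1 * 12, y - d.2 * 12) -> False.
  move=> H H'; suff E : a = a + scale d.
    case/eqP: d0; move: E; clear; case: a d => [x y] [x' y'] [E1 E2].
    by congr pair; lia.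
  apply: (@placed_uniq (a + (x, y)) a (a + scale d) k k') => //.
    by have -> : a + (x, y) - a = (x, y) by clear; cell_lia.
  have -> // : a + (x, y) - (a + scale d) = (x - d.1 * 12, y - d.2 * 12).
  by clear; cell_lia.
apply/contraT => Hf.
have : d \in [:: (1, 0); (-1, 0); (0, 1); (0, -1)].
  by apply/contraT => H; rewrite /fits H !orbT in Hf.
rewrite !inE; case/or4P => /eqP E; subst d; move: Hf;
  rewrite /fits !inE /= ?orbF => Hf.
- have [|H H'] := clash_right Hk' Hk; first by rewrite eq_sym.
  by case: (clash _ _ H'); rewrite mul1r addrK mul0r subr0.
- have [H H'] := clash_right Hk Hk' Hf.
  by case: (clash _ _ H); rewrite mulN1r opprK mul0r subr0.
- have [|H H'] := clash_up Hk' Hk; first by rewrite eq_sym (negbNE Hf).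
  by case: (clash _ _ H'); rewrite mul1r addrK mul0r subr0.
- have [H H'] := clash_up Hk Hk' (negbNE Hf).
  by case: (clash _ _ H); rewrite mulN1r opprK mul0r subr0.
Qed.

(** Some macro cell [a'] covers the inner end [a + (4, 7)] of the left dent. Three neighbours of
    that place belong to [a], so only the tip [(16, 7)] of a bump fits, and this fixes [a']. *)
Lemma placed_left (a : cell) (k : nat) :
  placed a k -> exists k', placed (a - (12, 0)) k'.
Proof.
move=> Ha; have [a' [k' [Ha' Hc]]] := placed_cover (a + (4, 7)).
have Hk := placed_lt Ha; have Hk' := placed_lt Ha'.
have [D1 D2 D3 D4] := dent_left Hk.
have aK (p : cell) : (a + p) - a = p by clear; cell_lia.
have Hn : a' <> a.
  by move=> E; subst a'; case/negP: D1; rewrite (placed_fun Ha Ha') -[(4, 7)]aK.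
have out (p q : cell) : in_shape k (q + p) -> q + p - p = (4, 7) ->
    ~~ in_shape k' (a + (4, 7) - a' + p).
  move=> H E; apply/negP => H'; apply: Hn; symmetry.
  apply: (@placed_uniq (a + (q + p)) a a' k k') => //; first by rewrite aK.
  by move: H'; rewrite -E addrK [a + q - _ + _]addrAC addrA.
have E : a + (4, 7) - a' = (16, 7).
  apply: (tip_right Hk' Hc); first exact: (out (1, 0) (4, 7)).
    exact: (out (0, 1) (4, 7)).
  exact: (out (0, -1) (4, 7)).
exists k'; suff -> : a - (12, 0) = a' by [].
by move: E; clear; case: a a' => [x y] [x' y'] [E1 E2]; congr pair => /=; lia.
Qed.

Lemma placed_down (a : cell) (k : nat) :
  placed a k -> exists k', placed (a - (0, 12)) k'.
Proof.
move=> Ha; have [a' [k' [Ha' Hc]]] := placed_cover (a + (7, 4)).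
have Hk := placed_lt Ha; have Hk' := placed_lt Ha'.
have [D1 D2 D3 D4] := dent_down Hk.
have aK (p : cell) : (a + p) - a = p by clear; cell_lia.
have Hn : a' <> a.
  by move=> E; subst a'; case/negP: D1; rewrite (placed_fun Ha Ha') -[(7, 4)]aK.
have out (p q : cell) : in_shape k (q + p) -> q + p - p = (7, 4) ->
    ~~ in_shape k' (a + (7, 4) - a' + p).
  move=> H E; apply/negP => H'; apply: Hn; symmetry.
  apply: (@placed_uniq (a + (q + p)) a a' k k') => //; first by rewrite aK.
  by move: H'; rewrite -E addrK [a + q - _ + _]addrAC addrA.
have E : a + (7, 4) - a' = (7, 16).
  apply: (tip_up Hk' Hc); first exact: (out (1, 0) (7, 4)).
    exact: (out (-1, 0) (7, 4)).
  exact: (out (0, 1) (7, 4)).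
exists k'; suff -> : a - (0, 12) = a' by [].
by move: E; clear; case: a a' => [x y] [x' y'] [E1 E2]; congr pair => /=; lia.
Qed.

Lemma placed_quadrant (a : cell) (k : nat) (i j : nat) :
  placed a k -> exists k', placed (a - scale (i%:Z, j%:Z)) k'.
Proof.
move=> Ha; elim: i => [|i [k1 IH]].
  elim: j => [|j [k1 IH]].
    by exists k; rewrite (_ : _ - _ = a) //; clear; cell_lia.
  have [k2 H2] := placed_down IH; exists k2.
  by rewrite (_ : _ - _ = a - scale (0%:Z, j%:Z) - (0, 12)) //; clear; cell_lia.
have [k2 H2] := placed_left IH; exists k2.
rewrite (_ : _ - _ = a - scale (i%:Z, j%:Z) - (12, 0)) //; clear; cell_lia.
Qed.

(** Going left and down from both macro cells leads to two whose origins differ by at most 6 in each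
    coordinate. Every shape contains the 7 x 7 square [[5, 12) x [5, 12)], so these two overlap and
    therefore coincide. *)
Lemma placed_congruent (a a' : cell) (k k' : nat) :
  placed a k -> placed a' k' -> exists w, a' = a + scale w.
Proof.
move=> Ha Ha'.
have mid (x : int) : exists q : int, -6 <= x - q * 12 <= 6.
  by exists ((x + 6) %/ 12)%Z; lia.
have [p Hp] := mid (a'.1 - a.1); have [q Hq] := mid (a'.2 - a.2).
have split_int (x : int) : exists i j : nat, x = j%:Z - i%:Z.
  by case: x => n; [exists 0%N, n | exists n.+1, 0%N]; lia.
have [i [i' Ei]] := split_int p; have [j [j' Ej]] := split_int q.
have [k1 H1] := placed_quadrant i j Ha.
have [k2 H2] := placed_quadrant i' j' Ha'.
have Hk1 := placed_lt H1; have Hk2 := placed_lt H2.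
exists (p, q).
suff : a - scale (i%:Z, j%:Z) = a' - scale (i'%:Z, j'%:Z).
  move: Ei Ej; clear; case: a a' => [x y] [x' y'] -> ->.
  by rewrite /scale /= => -[E1 E2]; congr pair => /=; lia.
move: Hp Hq H1 H2; case: a a' {Ha Ha'} => [x y] [x' y'] /= Hp Hq H1 H2.
set b : cell := _ - _ in H1 *; set b' : cell := _ - _ in H2 *.
have Hb : -6 <= b'.1 - b.1 <= 6 by rewrite /b /b' /scale /=; lia.
have Hb' : -6 <= b'.2 - b.2 <= 6 by rewrite /b /b' /scale /=; lia.
move: b b' H1 H2 Hb Hb' => [bx b_y] [bx' by'] H1 H2 /= Hb Hb'.
have common (u v : int) : -6 <= v - u <= 6 ->
    exists c, (5 <= c - u < 12) /\ (5 <= c - v < 12).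
  by move=> H; case: (leP u v) => Huv; [exists (v + 5) | exists (u + 5)]; lia.
have [cx [Hx Hx']] := common _ _ Hb; have [cy [Hy Hy']] := common _ _ Hb'.
by apply: (@placed_uniq (cx, cy) _ _ _ _ H1 H2); apply: in_shape_square.
Qed.

Lemma placed_grid (a : cell) (k : nat) (w : cell) :
  placed a k -> exists k', placed (a + scale w) k'.
Proof.
(* The macro cell covering this place is aligned with [a], and a shape stays within coordinates 0 to
   16, so 11 is the only residue class member available and the origin must be [a + scale w]. *)
move=> Ha; have [a' [k' [Ha' Hc]]] := placed_cover (a + scale w + (11, 11)).
have [w' E] := placed_congruent Ha Ha'; exists k'.
have /(in_shape_box (placed_lt Ha')) := Hc; rewrite mem_box => Hb.
rewrite (_ : a + scale w = a') //; move: Hb; rewrite E.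
move: w w' a {Ha Ha' Hc E} => [x y] [x' y'] [u v].
by rewrite /scale /= => Hb; congr pair => /=; lia.
Qed.

End Rigidity.

(* Tilings by patches of macro cells, in units of macro cells. *)
Definition macro_tiling (T : 'I_7 -> set cell) : Prop :=
  (forall m : cell, exists! iv : 'I_7 * cell,
     T iv.1 iv.2 /\ m - iv.2 \in patch iv.1) /\
  (forall (i i' : 'I_7) (v v' u u' : cell),
     T i v -> T i' v' -> u \in patch i -> u' \in patch i' ->
     v' + u' - (v + u) != 0 ->
     fits (patch_kind i u) (v' + u' - (v + u)) (patch_kind i' u')).

Lemma patch_base (i : 'I_7) : (0, (i != 0%N :> nat)%:Z) \in patch i.
Proof. by case: i => [[|[|[|[|[|[|[|[]]]]]]]] Hi]. Qed.

Lemma tiling_macro_tiling (T : 'I_7 -> set cell) : tiling piece T ->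
  exists o : cell, macro_tiling (fun i v => T i (o + scale v)) /\
    forall i v, T i v -> exists w, v = o + scale w.
Proof.
move=> tilT; have [o [k0 [Ho _]]] := placed_cover tilT 0; exists o.
have sub_placed (i : 'I_7) (v u : cell) : T i v -> u \in patch i ->
    placed T (v + scale u) (patch_kind i u).
  by move=> Ti Hu; exists i, v, u.
have place (i : 'I_7) (v u : cell) : T i (o + scale v) -> u \in patch i ->
    placed T (o + scale (v + u)) (patch_kind i u).
  by move=> Ti Hu; rewrite scaleD addrA; apply: sub_placed.
split; [split=> [m|i i' v v' u u' Ti Ti' Hu Hu' Hn]|move=> i v Ti].
- have [k [i [v [u [Ti Hu Ek E]]]]] := placed_grid tilT m Ho.
  have Ev : v = o + scale (m - u) by rewrite scaleB addrA E addrK.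
  exists (i, m - u); split=> [/=|[i' v'] [/= Ti' Hu']].
    by rewrite -Ev subKr.
  have mid p : o + scale m + (5, 5) - (o + scale p + scale (m - p)) = (5, 5).
    by move: p => p'; clear; destruct p'; cell_lia.
  have in5 j x : in_shape (patch_kind j x) (5, 5)
    by rewrite in_shape_square ?patch_kind_lt.
  rewrite Ev in Ti.
  have Hc : in_shape (patch_kind i u)
    (o + scale m + (5, 5) - (o + scale (m - u) + scale u)).
    by rewrite -{3}[u](subKr m) mid.
  have Hc' : in_shape (patch_kind i' (m - v'))
      (o + scale m + (5, 5) - (o + scale v' + scale (m - v'))) by rewrite mid.
  have [-> _ ->] := owner_uniq tilT Ti Hu Hc Ti' Hu' Hc'.
  by rewrite subKr.
- apply: (placed_fits tilT (place _ _ _ Ti Hu)) Hn.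
  have -> : o + scale (v + u) + scale (v' + u' - (v + u)) =
    o + scale (v' + u') by rewrite -addrA -scaleD [v + u + _]addrC subrK.
  exact: place.
have [w Hw] := placed_congruent tilT Ho (sub_placed _ _ _ Ti (patch_base i)).
exists (w - (0, (i != 0%N :> nat)%:Z)).
by rewrite scaleB addrA -Hw addrK.
Qed.

(** Existence comes from [cover_square] for the macro square containing [c]. For uniqueness, two
    shapes sharing [c] must be the same macro cell, since cells that fit do not overlap. *)
Lemma macro_tiling_tiling (T : 'I_7 -> set cell) : macro_tiling T ->
  tiling piece (fun i v => exists2 w, T i w & v = scale w).
Proof.
move=> [part fitT] c.
pose m : cell := ((c.1 %/ 12)%Z, (c.2 %/ 12)%Z).
pose hit (i : 'I_7) (v u : cell) :=
  [/\ T i v, u \in patch i & in_shape (patch_kind i u) (c - (scale (v + u)))].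
have [i [v [u [Ti Hu Hc]]]] : exists i v u, hit i v u.
  have [[i v] [[/= Ti Hu] _]] := part m.
  have [[il vl] [[/= Tl Hl] _]] := part (m - (1, 0)).
  have [[id vd] [[/= Td Hd] _]] := part (m - (0, 1)).
  have Fl := fitT _ _ _ _ _ _ Ti Tl Hu Hl.
  have Fd := fitT _ _ _ _ _ _ Ti Td Hu Hd.
  have sK (x y : cell) : x + (y - x) = y by rewrite addrC subrK.
  rewrite !sK in Fl, Fd.
  have dK (p : cell) : m - p - m = - p by rewrite addrAC subrr add0r.
  rewrite !dK in Fl, Fd.
  have {Fl}El : patch_kind i (m - v) = patch_kind il (m - (1, 0) - vl).
    by move: (Fl isT); rewrite /fits !inE /= ?orbF => /eqP.
  have {Fd}Ed : spacer (patch_kind id (m - (0, 1) - vd)) !=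
    spacer (patch_kind i (m - v)).
    by move: (Fd isT); rewrite /fits !inE /= ?orbF eq_sym.
  have := @cover_square (patch_kind i (m - v)) _ (c - scale m)
    (patch_kind_lt _ _) (patch_kind_lt _ _) Ed.
  have [-> ->] : 0 <= (c - scale m).1 < 12 /\ 0 <= (c - scale m).2 < 12.
    by rewrite /m /scale /=; lia.
  move=> /(_ isT isT) /or3P[H|H|H].
  - by exists i, v, (m - v); split; rewrite // sK.
  - exists il, vl, (m - (1, 0) - vl); split; rewrite // sK -El.
    by rewrite scaleB opprD opprK addrA.
  - exists id, vd, (m - (0, 1) - vd); split; rewrite // sK.
    by rewrite scaleB opprD opprK addrA.
exists (i, scale v); split=> [/=|[i' v'] [/= [w Ti' ->]]].
  split; first by exists v.
  exists (c - scale v); last by rewrite subrK.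
  by rewrite /= mem_piece; apply/piece_cellsP; exists u;
    rewrite // -addrA -opprD -scaleD.
move=> [x /= Hx E]; move: Hx; rewrite mem_piece => /piece_cellsP[u' Hu' Hc'].
have {}Hc' : in_shape (patch_kind i' u') (c - scale (w + u')).
  by move: Hc'; rewrite -E scaleD opprD addrA addrK.
have Em : w + u' = v + u.
  apply/eqP; rewrite -subr_eq0; apply/contraT => Hn.
  have := fitT _ _ _ _ _ _ Ti Ti' Hu Hu' Hn.
  by apply/contraLR => _; apply:
    (fits_overlap (patch_kind_lt _ _) (patch_kind_lt _ _) Hc Hc') Hn;
    rewrite -scaleD [v + u + _]addrC subrK.
have [[i0 v0] [_ Huniq]] := part (v + u).
have H1 := Huniq (i, v); have H2 := Huniq (i', w).
rewrite /= in H1 H2.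
have := H1 (conj Ti _); rewrite addrC addKr => /(_ Hu) E1.
have := H2 (conj Ti' _); rewrite -Em addrC addKr => /(_ Hu') E2.
by move: E2; rewrite E1 => -[-> ->].
Qed.

(** A period carries a copy to another copy; both lie on the grid through [o], so the period itself
    has the form [scale w]. *)
Lemma macro_tiling_period (T : 'I_7 -> set cell) (o : cell) :
  macro_tiling (fun i v => T i (o + scale v)) ->
  (forall i v, T i v -> exists w, v = o + scale w) -> periodic T ->
  exists2 w : cell, w != 0 & forall i v,
    T i (o + scale v) <-> T i (o + scale (v + w)).
Proof.
move=> [part _] Hgrid [p p0 Hp].
have per i v : T i v <-> T i (v + p).
  split=> Ti; last by move: Ti; rewrite -{1}(Hp i) => -[x Tx /addIr <-].
  by rewrite -(Hp i); exists v.
have [[i v] [[/= Ti _] _]] := part 0.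
have [w Hw] := Hgrid _ _ ((per _ _).1 Ti).
have Ep : p = scale (w - v) by rewrite scaleB -[p](addKr (o + scale v)) Hw addrC
  opprD addrACA subrr add0r.
exists (w - v).
- apply: contra_neq p0; rewrite Ep => ->.
  by rewrite /scale /= mul0r.
by move=> j x; rewrite scaleD addrA -Ep.
Qed.

(** * Bounded coboundaries *)

(** The sums of such an [f] over intervals are bounded, so [f] has mean 0. Equality of densities is
    expressed in this way, without limits. *)
Definition cob (f : int -> int) : Prop :=
  exists (h : int -> int) (C : int),
    forall x, `|h x| <= C /\ f x = h (x + 1) - h x.

Lemma cob_ext (f g : int -> int) : f =1 g -> cob f -> cob g.
Proof. by move=> E [h [C H]]; exists h, C => x; rewrite -E. Qed.

Lemma cobD (f g : int -> int) : cob f -> cob g -> cob (fun x => f x + g x).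
Proof.
move=> [h [C H]] [h' [C' H']]; exists (fun x => h x + h' x), (C + C') => x.
have [B E] := H x; have [B' E'] := H' x; split; lia.
Qed.

Lemma cobZ (n : int) (f : int -> int) : cob f -> cob (fun x => n * f x).
Proof.
move=> [h [C H]]; exists (fun x => n * h x), (`|n| * C) => x.
have [B E] := H x; split; first by rewrite normrM ler_wpM2l.
by rewrite E mulrBr.
Qed.

Lemma cob_translate (p : int) (f : int -> int) :
  cob f -> cob (fun x => f (x + p)).
Proof.
move=> [h [C H]]; exists (fun x => h (x + p)), C => x.
by have [B ->] := H (x + p); rewrite [x + 1 + p]addrAC.
Qed.

(** A bounded function and its translate have the same density: the difference is a telescoping sum
    of unit shifts, each with primitive a translate of [f]. *)
Lemma cob_shift (p C : int) (f : int -> int) :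
  (forall x, `|f x| <= C) -> cob (fun x => f (x + p) - f x).
Proof.
move=> Hf.
have pos (n : nat) : cob (fun x => f (x + n%:Z) - f x).
  elim: n => [|n IH].
    by exists (fun=> 0), 0 => x; rewrite addr0 !subrr.
  have step : cob (fun x => f (x + 1) - f x) by exists f, C.
  apply: cob_ext (cobD IH (cob_translate n step)) => x.
  rewrite (_ : x + n.+1%:Z = x + n%:Z + 1); last by lia.
  by rewrite addrC addrA subrK.
case: p => n; first exact: pos.
apply: cob_ext (cobZ (-1) (cob_translate (- n.+1%:Z) (pos n.+1))) => x.
by rewrite subrK mulN1r opprB NegzE.
Qed.

(** The primitive [h] would be nondecreasing and would rise by at least 1 infinitely often, hence be
    unbounded. *)
Lemma cob_recurrent (f : int -> int) :
  cob f -> (forall x, 0 <= f x) -> ~ (forall x, exists2 x', x <= x' & 0 < f x').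
Proof.
move=> [h [C H]] f0 rec.
have mono (x : int) (n : nat) : h x <= h (x + n%:Z).
  elim: n => [|n IH]; first by rewrite addr0.
  have := f0 (x + n%:Z); have [_ ->] := H (x + n%:Z).
  rewrite (_ : x + n%:Z + 1 = x + n.+1%:Z); lia.
have grow (n : nat) : exists x, h 0 + n%:Z <= h x.
  elim: n => [|n [x IH]]; first by exists 0; rewrite addr0.
  have [x' xx' fx'] := rec x; exists (x' + 1).
  have := mono x `|x' - x|%N; have [_ E] := H x'.
  rewrite (_ : x + _ = x'); lia.
have [x Hx] := grow (`|C| + `|C|).+1%N.
have [Bx _] := H x; have [B0 _] := H 0; lia.
Qed.

(** Over [n] periods the primitive grows by [n] times the sum over one period; taking [n] above
    twice the bound forces this sum to vanish. *)
Lemma cob_periodic (f : int -> int) (p : nat) : cob f ->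
  (forall x, f (x + p%:Z) = f x) -> \sum_(i < p) f i%:Z = 0.
Proof.
move=> [h [C H]] per; set S := \sum_(i < p) _.
have perN (n : nat) (x : int) : f ((n * p)%N%:Z + x) = f x.
  elim: n => [|n IH]; first by rewrite add0r.
  by rewrite mulSn PoszD -addrA addrC per.
have tele (n : nat) (x : int) : \sum_(i < n) f (x + i%:Z) = h (x + n%:Z) - h x.
  elim: n => [|n IH]; first by rewrite big_ord0 addr0 subrr.
  rewrite big_ord_recr IH /=; have [_ ->] := H (x + n%:Z).
  rewrite (_ : x + n%:Z + 1 = x + n.+1%:Z); lia.
have lin (n : nat) : h (n * p)%N%:Z = h 0 + n%:Z * S.
  elim: n => [|n IH]; first by rewrite mul0r addr0.
  have := tele p (n * p)%N%:Z; rewrite (eq_bigr (fun i : 'I_p => f i%:Z)).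
    by rewrite -/S -PoszD -mulSnr => /eqP; rewrite eq_sym subr_eq IH => /eqP ->;
      lia.
  by move=> i _; rewrite perN.
apply/eqP/contraT => S0.
pose n := (`|C| + `|C|).+1%N.
have [Bn _] := H (n * p)%N%:Z; have [B0 _] := H 0.
have : `|n%:Z * S| <= C + C.
  have -> : n%:Z * S = h (n * p)%N%:Z - h 0 by rewrite lin addrC addKr.
  by rewrite (le_trans (ler_normB _ _)) // lerD.
have : n%:Z <= `|n%:Z * S| by rewrite normrM; have : 1 <= `|S|; nia.
rewrite /n; lia.
Qed.

(** * Rows of a tiling *)

Definition patch_top (i : nat) (u : cell) : bool := u + (0, 1) \in patch i.
Definition patch_bottom (i : nat) (u : cell) : bool := u - (0, 1) \in patch i.

Definition kind_tops (k : nat) : int := if k == 1%N then 1 else 3.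

(* Both kinds of strip have two bottom teeth, so this running difference
   vanishes again at the right end of the strip. *)
Definition excess (i : nat) (l : int) : int :=
  kind_tops (piece_kind i) * (count (fun b : nat => (2 * b)%N%:Z < l)
    (bottoms i))%:Z -
  2 * (count (fun t : nat => (2 * t)%N%:Z < l) (tops i))%:Z.

Lemma patch_ind (Q : nat -> cell -> bool) :
  all (fun i => all (Q i) (patch i)) (iota 0 7) ->
  forall (i : 'I_7) u, u \in patch i -> Q i u.
Proof.
move=> /allP H i u; apply: (allP (H i _)); by rewrite mem_iota ltn_ord.
Qed.

Lemma patch_excess (i : 'I_7) (u : cell) : u \in patch i -> u.2 = 1 ->
  (if u + (1, 0) \in patch i then excess i (u.1 + 1) else 0) =
  excess i u.1 + kind_tops (piece_kind i) * (patch_bottom i u)%:Z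
    - 2 * (patch_top i u)%:Z.
Proof.
pose Q i (u : cell) := (u.2 == 1) ==>
  ((if u + (1, 0) \in patch i then excess i (u.1 + 1) else 0) ==
   excess i u.1 + kind_tops (piece_kind i) * (patch_bottom i u)%:Z
     - 2 * (patch_top i u)%:Z).
move=> Hu u2; have : Q i u by apply: (@patch_ind Q _ i u Hu); vm_compute.
by rewrite /Q u2 eqxx => /eqP.
Qed.

Lemma patch_local (i : 'I_7) (u : cell) : u \in patch i ->
  [/\ 0 <= u.1 < 24, (u.2 \in [:: 0; 1; 2]),
      (u.2 != 1) = spacer (patch_kind i u) & `|excess i u.1| <= 100].
Proof.
pose Q i (u : cell) := [&& 0 <= u.1 < 24, (u.2 \in [:: 0; 1; 2]),
      (u.2 != 1) == spacer (patch_kind i u) & `|excess i u.1| <= 100].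
move=> Hu; have : Q i u by apply: (@patch_ind Q _ i u Hu); vm_compute.
by case/and4P => H1 H2 /eqP H3 H4; split.
Qed.

Lemma patch_strip (i : 'I_7) (u : cell) : u \in patch i -> u.2 = 1 ->
  [/\ i != 0%N :> nat,
      u.1 != 0 -> u - (1, 0) \in patch i,
      u + (1, 0) \notin patch i -> odd `|u.1|%N,
      excess i 0 = 0 &
      exists b t : nat, (b%:Z, 0) \in patch i /\ (t%:Z, 2) \in patch i].
Proof.
pose Q i (u : cell) := (u.2 == 1) ==>
  [&& i != 0%N, (u.1 != 0) ==> (u - (1, 0) \in patch i),
   (u + (1, 0) \notin patch i) ==> odd `|u.1|%N, excess i 0 == 0,
   ((2 * head 0%N (bottoms i))%N%:Z, 0) \in patch i
   & ((2 * head 0%N (tops i))%N%:Z, 2) \in patch i].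
move=> Hu u2; have : Q i u by apply: (@patch_ind Q _ i u Hu); vm_compute.
rewrite /Q u2 eqxx /= => /and5P[H1 /implyP H2 /implyP H3 /eqP H4].
move=> /andP[H5 H6]; split=> //.
by exists (2 * head 0%N (bottoms i))%N, (2 * head 0%N (tops i))%N.
Qed.

Lemma patch_tooth (i : 'I_7) (u : cell) : u \in patch i -> i != 0%N :> nat ->
  (u.2 = 0 -> u + (0, 1) \in patch i /\ ~~ odd `|u.1|%N) /\
  (u.2 = 2 -> u - (0, 1) \in patch i /\ ~~ odd `|u.1|%N).
Proof.
pose Q i (u : cell) := (i != 0%N) ==>
  ((u.2 == 0) ==> (u + (0, 1) \in patch i) && ~~ odd `|u.1|%N) &&
  ((u.2 == 2) ==> (u - (0, 1) \in patch i) && ~~ odd `|u.1|%N).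
move=> Hu i0; have : Q i u by apply: (@patch_ind Q _ i u Hu); vm_compute.
rewrite /Q i0 => /andP[/implyP H1 /implyP H2].
by split=> /eqP E; [have /andP := H1 E | have /andP := H2 E].
Qed.

Lemma int_const (A : Type) (f : int -> A) :
  (forall x, f (x + 1) = f x) -> forall x y, f x = f y.
Proof.
move=> H; have pos (x : int) (n : nat) : f (x + n%:Z) = f x.
  elim: n => [|n IH]; first by rewrite addr0.
  by rewrite -IH -(H (x + n%:Z)); congr f; lia.
move=> x y; case: (leP x y) => Hxy.
  by rewrite -(pos x `|y - x|%N); congr f; lia.
by rewrite -(pos y `|x - y|%N); congr f; lia.
Qed.

Lemma fstD (u v : cell) : (u + v).1 = u.1 + v.1. Proof. by []. Qed.
Lemma sndD (u v : cell) : (u + v).2 = u.2 + v.2. Proof. by []. Qed.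
Lemma fstB (u v : cell) : (u - v).1 = u.1 - v.1. Proof. by []. Qed.
Lemma sndB (u v : cell) : (u - v).2 = u.2 - v.2. Proof. by []. Qed.
Definition coordE := (fstB, sndB, fstD, sndD).

Lemma patch_domino (u : cell) :
  (u \in patch 0) = (u == (0, 0)) || (u == (1, 0)).
Proof. by rewrite /patch !inE. Qed.

Section Rows.

Variable T : 'I_7 -> set cell.
Hypothesis mt : macro_tiling T.

Definition owner (m : cell) : 'I_7 * cell := projT1 (cid (mt.1 m)).

Lemma owner_eq (i : 'I_7) (v u : cell) :
  T i v -> u \in patch i -> owner (v + u) = (i, v).
Proof.
move=> Ti Hu; rewrite /owner; case: cid => iv [_ H] /=; apply: H => /=.
by rewrite addrC addKr.
Qed.

Definition piece_at (m : cell) : 'I_7 := (owner m).1.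
Definition offset (m : cell) : cell := m - (owner m).2.
Definition kind (m : cell) : nat := patch_kind (piece_at m) (offset m).

Lemma owner_placed (m : cell) : T (piece_at m) (owner m).2.
Proof. by rewrite /piece_at /owner; case: cid => iv [[]]. Qed.

Lemma offset_in_patch (m : cell) : offset m \in patch (piece_at m).
Proof. by rewrite /piece_at /offset /owner; case: cid => iv [[]]. Qed.

Lemma owner_shift (m d : cell) : offset m + d \in patch (piece_at m) ->
  piece_at (m + d) = piece_at m /\ offset (m + d) = offset m + d.
Proof.
move=> /(owner_eq (owner_placed m));
  rewrite /offset addrA [_ + (m - _)]addrC subrK => E.
by rewrite /piece_at /offset E addrAC.
Qed.

Lemma kind_fits (m d : cell) : d != 0 -> fits (kind m) d (kind (m + d)).
Proof.
move=> d0; have [_ H] := mt.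
have := H _ _ _ _ _ _ (owner_placed m) (owner_placed (m + d))
  (offset_in_patch m) (offset_in_patch (m + d)).
have E x : (owner x).2 + offset x = x by rewrite /offset addrC subrK.
by rewrite !E addrAC subrr add0r; apply.
Qed.

Lemma kind_right (m : cell) : kind (m + (1, 0)) = kind m.
Proof.
by have := @kind_fits m (1, 0) isT; rewrite /fits !inE /= ?orbF => /eqP.
Qed.

Lemma kind_up (m : cell) : spacer (kind (m + (0, 1))) = ~~ spacer (kind m).
Proof.
have := @kind_fits m (0, 1) isT; rewrite /fits !inE /= ?orbF.
by case: spacer; case: spacer.
Qed.

Lemma kind_row (x x' y : int) : kind (x, y) = kind (x', y).
Proof.
apply: (int_const (f := fun x => kind (x, y))) => z.
by rewrite -(kind_right (z, y)); congr kind; congr pair => /=; lia.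
Qed.

Lemma strip_rowE (m : cell) : ((offset m).2 == 1) = ~~ spacer (kind m).
Proof.
by have [_ _ H _] := patch_local (offset_in_patch m); rewrite /kind -H negbK.
Qed.

Definition top_at (m : cell) : bool := patch_top (piece_at m) (offset m).
Definition bottom_at (m : cell) : bool := patch_bottom (piece_at m) (offset m).
Definition parity (m : cell) : bool := odd `|(offset m).1|%N.

(** If the next cell were not the first one of its strip, its left neighbour [m] would belong to the
    same copy. *)
Lemma next_strip (m : cell) : ~~ spacer (kind m) ->
  offset m + (1, 0) \notin patch (piece_at m) -> offset (m + (1, 0)) = (0, 1).
Proof.
move=> Hm Hn; have Hm' : ~~ spacer (kind (m + (1, 0))) by rewrite kind_right.
have strip1 : (offset (m + (1, 0))).2 = 1 by apply/eqP; rewrite strip_rowE.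
have [_ H _ _ _] := patch_strip (offset_in_patch _) strip1.
have [E|/H /owner_shift] := eqVneq (offset (m + (1, 0))).1 0.
  by move: E strip1; case: (offset _) => x y /= -> ->.
rewrite addrK => -[E1 E2].
by case/negP: Hn; rewrite E1 E2 subrK offset_in_patch.
Qed.

(** Strips have even length and abut along a row, so parity alternates across their ends as well. As
    teeth sit at even positions, all teeth of a strip row lie in one parity class. *)
Lemma parity_right (m : cell) : ~~ spacer (kind m) ->
  parity (m + (1, 0)) = ~~ parity m.
Proof.
move=> Hm; have strip1 : (offset m).2 = 1 by apply/eqP; rewrite strip_rowE.
have [_ _ H _ _] := patch_strip (offset_in_patch _) strip1.
have [/andP[l0 _] _ _ _] := patch_local (offset_in_patch m).
case Hn: (offset m + (1, 0) \in patch (piece_at m)).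
  by have [_ E] := owner_shift Hn; rewrite /parity E /=; lia.
by rewrite /parity (next_strip Hm) ?Hn // H ?Hn.
Qed.

(** The primitive is [excess] of the strip at hand: it is 0 at both ends of every strip, so the
    values on consecutive strips glue together. *)
Lemma cob_row (y : int) : ~~ spacer (kind (0, y)) ->
  cob (fun x => kind_tops (kind (0, y)) * (bottom_at (x, y))%:Z
    - 2 * (top_at (x, y))%:Z).
Proof.
move=> Hy; exists (fun x => excess (piece_at (x, y)) (offset (x, y)).1), 100 =>
  x.
have [_ _ _ B] := patch_local (offset_in_patch (x, y)); split=> //.
have Hx : ~~ spacer (kind (x, y)) by rewrite (kind_row x 0).
have strip1 : (offset (x, y)).2 = 1 by apply/eqP; rewrite strip_rowE.
have E := patch_excess (offset_in_patch _) strip1.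
have -> : kind (0, y) = piece_kind (piece_at (x, y)).
  by rewrite (kind_row 0 x) /kind /patch_kind strip1.
have Em : (x + 1, y) = (x, y) + (1, 0) by congr pair; rewrite /= addr0.
rewrite /top_at /bottom_at Em; move: E.
case: ifPn => [Hn|Hn] E.
  have [-> ->] := owner_shift Hn.
  by rewrite coordE E; lia.
have op1 := next_strip Hx Hn.
have Hl : (offset ((x, y) + (1, 0))).2 = 1 by rewrite op1.
have [_ _ _ E0 _] := patch_strip (offset_in_patch _) Hl.
by rewrite op1 E0; lia.
Qed.

Lemma kind_down (m : cell) : spacer (kind (m - (0, 1))) = ~~ spacer (kind m).
Proof. by rewrite -{2}(subrK (0, 1) m) kind_up negbK. Qed.

Definition is_bottom (m : cell) : bool :=
  (piece_at m != 0%N :> nat) && ((offset m).2 == 0).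
Definition is_top (m : cell) : bool :=
  (piece_at m != 0%N :> nat) && ((offset m).2 == 2).
Definition domino_right (m : cell) : bool :=
  (piece_at m == 0%N :> nat) && (offset m == (1, 0)).
Definition domino_left (m : cell) : bool :=
  (piece_at m == 0%N :> nat) && (offset m == (0, 0)).

Lemma bottom_at_above (m : cell) : spacer (kind m) ->
  bottom_at (m + (0, 1)) = is_bottom m.
Proof.
move=> Hm; have Hm' : ~~ spacer (kind (m + (0, 1))) by rewrite kind_up Hm.
have strip1 : (offset (m + (0, 1))).2 = 1 by apply/eqP; rewrite strip_rowE.
apply/idP/idP => [/owner_shift|/andP[H0 /eqP H2]].
  have [H0 _ _ _ _] := patch_strip (offset_in_patch _) strip1.
  by rewrite addrK /is_bottom => -[-> ->]; rewrite H0 coordE strip1.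
have [/(_ H2) [/owner_shift [E1 E2] _] _] := patch_tooth (offset_in_patch m) H0.
by rewrite /bottom_at /patch_bottom E1 E2 addrK offset_in_patch.
Qed.

Lemma top_at_below (m : cell) : spacer (kind m) ->
  top_at (m - (0, 1)) = is_top m.
Proof.
move=> Hm; have Hm' : ~~ spacer (kind (m - (0, 1))) by rewrite kind_down Hm.
have strip1 : (offset (m - (0, 1))).2 = 1 by apply/eqP; rewrite strip_rowE.
apply/idP/idP => [/owner_shift|/andP[H0 /eqP H2]].
  have [H0 _ _ _ _] := patch_strip (offset_in_patch _) strip1.
  by rewrite subrK /is_top => -[-> ->]; rewrite H0 coordE strip1.
have [_ /(_ H2) [/owner_shift [E1 E2] _]] := patch_tooth (offset_in_patch m) H0.
by rewrite /top_at /patch_top E1 E2 subrK offset_in_patch.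
Qed.

Lemma bottom_parity (m : cell) : is_bottom m -> parity (m + (0, 1)) = false.
Proof.
move=> /andP[H0 /eqP H2].
have [/(_ H2) [/owner_shift [_ E] He] _] := patch_tooth (offset_in_patch m) H0.
by rewrite /parity E coordE addr0; apply: negbTE.
Qed.

Lemma top_parity (m : cell) : is_top m -> parity (m - (0, 1)) = false.
Proof.
move=> /andP[H0 /eqP H2].
have [_ /(_ H2) [/owner_shift [_ E] He]] := patch_tooth (offset_in_patch m) H0.
by rewrite /parity E coordE subr0; apply: negbTE.
Qed.

Lemma domino_right_next (m : cell) : domino_right (m + (1, 0)) = domino_left m.
Proof.
apply/idP/idP => /andP[H0 /eqP El].
  have : offset (m + (1, 0)) - (1, 0) \in patch (piece_at (m + (1, 0))).
    by rewrite (eqP H0) patch_domino El subrr eqxx.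
  by move=> /owner_shift; rewrite addrK /domino_left => -[-> ->];
    rewrite H0 El subrr eqxx.
have : offset m + (1, 0) \in patch (piece_at m)
  by rewrite (eqP H0) patch_domino El.
by rewrite /domino_right => /owner_shift[-> ->]; rewrite H0 El eqxx.
Qed.

Lemma spacer_cell (m : cell) : spacer (kind m) ->
  (domino_left m + domino_right m + is_bottom m + is_top m = 1)%N.
Proof.
move=> Hm; have := offset_in_patch m; have [_ H2 Ek _] :=
  patch_local (offset_in_patch m).
move: Ek; rewrite /kind in Hm; rewrite Hm /domino_left /domino_right /is_bottom
  /is_top.
case: (piece_at m == 0%N :> nat) / eqP => [->|_] Hn.
  by rewrite patch_domino => /orP[] /eqP ->.
by move: H2 Hn; rewrite !inE => /or3P[] /eqP ->.
Qed.

(* The dominoes between consecutive teeth of a spacer row put these at an odd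
   distance, whereas the teeth of one row of strips all have the same parity.
   So teeth from above and from below alternate, and the phase tells which of
   the two comes next. *)
Definition phase (m : cell) : bool := parity (m + (0, 1)) (+) domino_right m.

(** Parity flips at each step. On either half of a domino [domino_right] flips too and compensates;
    at a tooth it stays false, so the phase changes. *)
Lemma phase_right (m : cell) : spacer (kind m) ->
  phase (m + (1, 0)) = phase m (+) (is_bottom m || is_top m).
Proof.
move=> Hm; rewrite /phase domino_right_next addrAC parity_right ?kind_up ?Hm //.
have := spacer_cell Hm.
by case: (parity _); case: domino_left; case: domino_right; case: is_bottom;
  case: is_top.
Qed.

Lemma strip_teeth (x y : int) : ~~ spacer (kind (x, y)) ->
  (exists2 x' : int, x <= x' & is_bottom (x', y - 1)) /\
    (exists2 x' : int, x <= x' & top_at (x', y)).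
Proof.
(* A strip is at most 24 macro cells long, so the one through [x + 24] starts to the right of [x],
   and so do its teeth. *)
move=> Hy; have Hx : ~~ spacer (kind (x + 24, y)) by rewrite (kind_row _ x).
have strip1 : (offset (x + 24, y)).2 = 1 by apply/eqP; rewrite strip_rowE.
have [H0 _ _ _ [b [t [Hb Ht]]]] := patch_strip (offset_in_patch _) strip1.
have [Hl _ _ _] := patch_local (offset_in_patch (x + 24, y)).
have [_ /(_ erefl) [Ht' _]] := patch_tooth Ht H0.
have := owner_eq (owner_placed _) Hb; have := owner_eq (owner_placed _) Ht'.
move: strip1 Hl H0 Hb Ht Ht'; rewrite {1 2 3}/offset.
case: (owner (x + 24, y)).2 => v1 v2 /= strip1 Hl H0 Hb Ht Ht' Et Eb.
split.
  exists (v1 + b%:Z); first by lia.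
  have -> : (v1 + b%:Z, y - 1) = (v1, v2) + (b%:Z, 0).
    by congr pair => /=; lia.
  rewrite /is_bottom /offset /piece_at Eb H0 /=; lia.
exists (v1 + t%:Z); first by lia.
have E : (v1 + t%:Z, y) = (v1, v2) + ((t%:Z, 2) - (0, 1)).
  by congr pair => /=; lia.
by rewrite /top_at /offset /piece_at E Et /=
  addrAC subrr add0r /patch_top subrK.
Qed.

Lemma cell_up (x y : int) : (x, y + 1) = (x, y) + (0, 1).
Proof. by congr pair; rewrite /= addr0. Qed.

Lemma cell_down (x y : int) : (x, y - 1) = (x, y) - (0, 1).
Proof. by congr pair; rewrite /= subr0. Qed.

Lemma cell_right (x y : int) : (x + 1, y) = (x, y) + (1, 0).
Proof. by congr pair; rewrite /= addr0. Qed.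

Lemma bottom_phase (m : cell) : is_bottom m -> phase m = false.
Proof.
by move=> H; rewrite /phase bottom_parity // /domino_right;
  case/andP: H => /negbTE ->.
Qed.

(** Were the parities above and below equal, teeth of both sorts would occur only at phase false.
    After a bottom tooth the phase would turn true and stay so, which excludes the later bottom
    teeth given by [strip_teeth]. *)
Lemma phase_alternate (x y : int) : spacer (kind (0, y)) ->
  parity (x, y + 1) (+) parity (x, y - 1).
Proof.
move=> Hy; have Hw z : spacer (kind (z, y)) by rewrite (kind_row z 0).
have Hup z : ~~ spacer (kind (z, y + 1)) by rewrite cell_up kind_up Hw.
have Hdn z : ~~ spacer (kind (z, y - 1)) by rewrite cell_down kind_down Hw.
apply/contraT => /negbTE Hx.
have Hd z : parity (z, y + 1) (+) parity (z, y - 1) = false.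
  rewrite -Hx.
  apply: (int_const (f := fun z => parity (z, y + 1) (+) parity (z, y - 1))) =>
    t.
  by rewrite !cell_right !parity_right // addbN addNb negbK.
have top_phase z : is_top (z, y) -> phase (z, y) = false.
  move=> H; have := Hd z; rewrite cell_down (top_parity H) addbF cell_up => E.
  by rewrite /phase E /domino_right; case/andP: H => /negbTE ->.
have grow z : phase (z, y) -> phase (z + 1, y).
  move=> H; rewrite cell_right phase_right // H.
  case Hb: (is_bottom _); first by rewrite bottom_phase in H.
  by case Ht: (is_top _); first by rewrite top_phase in H.
have [[x0 _ H0] _] := strip_teeth (Hup 0); rewrite addrK in H0.
have P1 : phase (x0 + 1, y).
  by rewrite cell_right phase_right // H0 (bottom_phase H0).
have Pn (n : nat) : phase (x0 + 1 + n%:Z, y).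
  elim: n => [|n IH]; first by rewrite addr0.
  by rewrite (_ : _ + _ = x0 + 1 + n%:Z + 1) ?grow //; lia.
have [[x1 Hx1 H1] _] := strip_teeth (Hup (x0 + 1)); rewrite addrK in H1.
have := Pn `|(x1 - x0 - 1)%R|%N; rewrite (_ : _ + _ = x1) ?bottom_phase //; lia.
Qed.

(** The phase is the primitive: by [phase_alternate] a bottom tooth raises it from 0 to 1, a top
    tooth lowers it from 1 to 0, and dominoes keep it. *)
Lemma cob_gap (y : int) : spacer (kind (0, y)) ->
  cob (fun x => (bottom_at (x, y + 1))%:Z - (top_at (x, y - 1))%:Z).
Proof.
move=> Hy; exists (fun x => (phase (x, y))%:Z), 1 => x.
split; first by case: phase.
have Hw : spacer (kind (x, y)) by rewrite (kind_row x 0).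
have := phase_alternate x Hy; have := spacer_cell Hw; have := phase_right Hw.
have := @bottom_phase (x, y); have := @top_parity (x, y).
rewrite cell_up cell_down cell_right bottom_at_above // top_at_below // =>
  Ht Hb ->.
move=> Hc Ha; have : is_top (x, y) -> phase (x, y) by
  move=> H; move: Ha; rewrite /phase (Ht H) addbF => ->; case/andP: H;
  rewrite /domino_right => /negbTE ->.
move: Hb Hc; case: (phase _); case: is_bottom; case: is_top; case: domino_left;
  case: domino_right => //=;
  try (by move=> /(_ isT)); by move=> _ _ /(_ isT).
Qed.

Lemma spacer_row (y : int) (n : nat) :
  spacer (kind (0, y + n%:Z)) = spacer (kind (0, y)) (+) odd n.
Proof.
elim: n => [|n IH]; first by rewrite addr0 addbF.
rewrite (_ : y + n.+1%:Z = y + n%:Z + 1); last by lia.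
by rewrite cell_up kind_up IH -addbN.
Qed.

(** Going up one strip row multiplies the density of top teeth by [c / 2] with [c] equal to 1 or 3;
    [n] is the product of these [c]. *)
Lemma cob_rows (y : int) (k : nat) : ~~ spacer (kind (0, y)) ->
  exists2 n : nat, odd n &
    cob (fun x => (2 ^ k)%N%:Z * (top_at (x, y + (k.*2)%:Z))%:Z
      - n%:Z * (top_at (x, y))%:Z).
Proof.
move=> Hy; elim: k => [|k [n n_odd IH]].
  exists 1%N => //; exists (fun=> 0), 0 => x; rewrite addr0 !mul1r !subrr.
  by [].
set y' := y + (k.*2)%:Z in IH.
have Hy' : ~~ spacer (kind (0, y')) by rewrite spacer_row odd_double addbF.
have HW : spacer (kind (0, y' + 1)) by rewrite cell_up kind_up Hy'.
have Hy2 : ~~ spacer (kind (0, y' + 1 + 1)) by rewrite cell_up kind_up HW.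
have C1 := cob_row Hy2; have C2 := cob_gap HW; rewrite addrK in C2.
have [c c_odd Ec] : exists2 c : nat, odd c & kind_tops (kind (0, y' + 1 + 1)) =
  c%:Z.
  by rewrite /kind_tops; case: ifP => _; [exists 1%N | exists 3%N].
rewrite Ec in C1; exists (c * n)%N; first by rewrite oddM c_odd.
(* In this combination the bottom teeth cancel, and so do the top teeth of row [y']. *)
apply: cob_ext (cobD (cobD (cobZ (- (2 ^ k)%N%:Z) C1)
  (cobZ ((2 ^ k)%N%:Z * c%:Z) C2)) (cobZ c%:Z IH)) => x.
have -> : y + (k.+1.*2)%:Z = y' + 1 + 1 by rewrite /y'; lia.
rewrite expnS !PoszM; ring.
Qed.

End Rows.

(** * Exclusion of periods *)

Section Period.

Variables (T : 'I_7 -> set cell) (w : cell).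
Hypothesis mt : macro_tiling T.
Hypothesis per : forall i v, T i v <-> T i (v + w).

Lemma owner_period (m : cell) :
  piece_at mt (m + w) = piece_at mt m /\ offset mt (m + w) = offset mt m.
Proof.
have := owner_eq mt ((per _ _).1 (owner_placed mt m)) (offset_in_patch mt m).
rewrite addrAC [_ + offset mt m]addrC {2}/offset subrK => E.
by rewrite /piece_at /offset E opprD addrACA subrr addr0.
Qed.

Lemma top_at_period (m : cell) : top_at mt (m + w) = top_at mt m.
Proof. by rewrite /top_at; have [-> ->] := owner_period m. Qed.

Lemma kind_period (m : cell) : kind mt (m + w) = kind mt m.
Proof. by rewrite /kind; have [-> ->] := owner_period m. Qed.

Lemma strip_row_exists : exists y, ~~ spacer (kind mt (0, y)).
Proof.
case H: (spacer (kind mt (0, 0))); last by exists 0; rewrite H.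
by exists 1; rewrite -[(0, 1)](add0r (0, 1)) kind_up H.
Qed.

Lemma top_at_recurrent (c : int) (y : int) : ~~ spacer (kind mt (0, y)) ->
  c != 0 ->
  ~ cob (fun x => c * (top_at mt (x, y))%:Z).
Proof.
(* Multiplying by [c] once more gives the coefficient [c ^ 2], positive whatever the sign of [c]. *)
move=> Hy c0 /(cobZ c) /cob_recurrent; apply.
  by move=> x; rewrite mulrA mulr_ge0 // -expr2 sqr_ge0.
move=> x; have Hx : ~~ spacer (kind mt (x, y)) by rewrite (kind_row _ x 0).
have [_ [x' xx' Hf]] := strip_teeth Hx; exists x' => //.
by rewrite Hf mulr1 -expr2 exprn_even_gt0.
Qed.

Lemma odd_neq_pow (n k : nat) : odd n -> (0 < k)%N ->
  (2 ^ k)%N%:Z - n%:Z != 0.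
Proof.
move=> Hn k0; rewrite subr_eq0; apply/eqP => -[E].
by move: Hn; rewrite -E oddX orbF => /eqP k00; rewrite k00 in k0.
Qed.

(** Spacer and strip rows alternate, so [w.2] is even, say [2 * k]. Periodicity identifies row
    [y + w.2] with row [y] up to a horizontal shift, which does not affect density, so [cob_rows]
    makes [2 ^ k - n] times the top teeth a bounded coboundary. *)
Lemma period_up : 0 < w.2 -> False.
Proof.
move=> w2; have [y Hy] := strip_row_exists.
have [n En] : exists n : nat, w.2 = n%:Z by exists `|w.2|%N; lia.
have : spacer (kind mt (0, y + n%:Z)) = spacer (kind mt (0, y)).
  rewrite -(kind_period (0, y)) (kind_row mt 0 w.1); congr (spacer (kind mt _)).
  by rewrite -En; case: (w) => a b; congr pair; rewrite /= ?add0r.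
rewrite spacer_row => Hn.
have n_even : ~~ odd n by move: Hn; case: (spacer _); case: odd.
have En2 := even_halfK n_even.
have [c c_odd Hc] := cob_rows (n./2) Hy; rewrite En2 -En in Hc.
have k0 : (0 < n./2)%N by lia.
apply: (top_at_recurrent Hy (odd_neq_pow c_odd k0)).
have Bf x : `|(top_at mt (x, y))%:Z| <= 1 :> int by case: top_at.
apply: cob_ext (cobD (cob_translate w.1 Hc) (cobZ c%:Z (cob_shift w.1 Bf))) =>
  x.
rewrite (_ : (x + w.1, y + w.2) = (x, y) + w); last by case: (w).
rewrite top_at_period; ring.
Qed.

(** With [S z] the number of top teeth of row [z] per period, [cob_rows] and [cob_periodic] give
    [2 ^ k * S (y + 2 * k) = n * S y] with [n] odd. So every [2 ^ k] divides [S y], which is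
    positive and at most [p]. *)
Lemma period_right : w.2 = 0 -> 0 < w.1 -> False.
Proof.
move=> w2 w1; have [y Hy] := strip_row_exists.
have [p Ep] : exists p : nat, w.1 = p%:Z by exists `|w.1|%N; lia.
pose S z := (\sum_(i < p) top_at mt (i%:Z, z))%N.
have perf z x : top_at mt (x + p%:Z, z) = top_at mt (x, z).
  rewrite -(top_at_period (x, z)) -Ep; congr (top_at mt _).
  by move: w2; case: (w) => a b /= ->; congr pair; rewrite /= addr0.
have S_dvd (k : nat) : (2 ^ k %| S y)%N.
  have [n n_odd Hc] := cob_rows k Hy.
  have H0 := cob_periodic (p := p) Hc.
  have {H0} : \sum_(i < p) ((2 ^ k)%N%:Z * (top_at mt (i%:Z, y + (k.*2)%:Z))%:Z
    -
      n%:Z * (top_at mt (i%:Z, y))%:Z) = 0 by apply: H0 => x; rewrite !perf.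
  rewrite sumrB -!mulr_sumr => /eqP; rewrite subr_eq0 => /eqP H.
  have E : (2 ^ k * S (y + (k.*2)%:Z)%R = n * S y)%N.
    apply/eqP; rewrite -eqz_nat !PoszM; apply/eqP.
    by rewrite /S !(big_morph Posz PoszD (erefl 0%Z)).
  have : (2 ^ k %| n * S y)%N by rewrite -E dvdn_mulr.
  by rewrite Gauss_dvdr // coprimeXl // coprime2n.
have S0 : (0 < S y)%N.
  have [_ [x' _ Hf]] := strip_teeth (x := 0) Hy.
  have x'mod : top_at mt ((x' %% p)%Z, y).
    set r := (x' %% p)%Z.
    have E q : top_at mt (r + q * p%:Z, y) = top_at mt (r + 0 * p%:Z, y).
      apply: (int_const (f := fun q => top_at mt (r + q * p%:Z, y))) => t.
      by rewrite mulrDl mul1r addrA perf.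
    rewrite -[r]addr0 -(mul0r p%:Z) -(E (x' %/ p)%Z).
    by rewrite addrC -divz_eq.
  have Hp : (`|(x' %% p)%Z| < p)%N by lia.
  rewrite /S (bigD1 (Ordinal Hp)) //= gez0_abs ?x'mod //; lia.
have SP : (S y <= p)%N.
  rewrite -[X in (_ <= X)%N]card_ord -sum1_card; apply: leq_sum => i _.
  exact: leq_b1.
have := dvdn_leq S0 (S_dvd p); have := ltn_expl p (isT : 1 < 2)%N; lia.
Qed.

End Period.

Lemma macro_tiling_aperiodic (T : 'I_7 -> set cell) (w : cell) :
  macro_tiling T -> w != 0 -> ~ (forall i v, T i v <-> T i (v + w)).
Proof.
move=> mt w0 per.
have perN i v : T i v <-> T i (v + (- w)).
  by split=> H; [apply: (per _ _).2 | have := (per _ _).1 H]; rewrite subrK.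
case: (ltgtP w.2 0) => w2.
- by apply: (period_up mt perN) => /=; lia.
- exact: (period_up mt per).
case: (ltgtP w.1 0) => w1.
- by apply: (period_right mt perN) => /=; lia.
- exact: (period_right mt per).
by case/eqP: w0; move: w1 w2; case: (w) => a b /= -> ->.
Qed.

(** * Interleaving of the teeth *)

(** The floor as a pair of inequalities, a form that linear arithmetic can use. *)
Definition floor_of (x : rat) (n : int) : Prop := n%:~R <= x < n%:~R + 1.

Definition top_count (a : rat) : nat := if 2 <= a then 1%N else 3%N.

(* The strip of width w in a row whose bottom teeth (for gap_piece, top teeth)
   have mean distance 4 * a. *)
Definition above_piece (a : rat) (w : int) : nat :=
  if a < 3 / 2 then `|w|.-1%N else `|w|%N.
Definition gap_piece (a : rat) (w : int) : nat :=
  if 2 <= a then `|w|.-1%N else `|w|%N.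

Lemma int_itv (lo hi w : int) :
  lo%:~R - 1 < w%:~R :> rat -> w%:~R < hi%:~R + 1 :> rat -> lo <= w <= hi.
Proof.
rewrite -[lo%:~R - 1]/(lo%:~R - 1%:~R) -[hi%:~R + 1]/(hi%:~R + 1%:~R).
rewrite -intrB -intrD !ltr_int; lia.
Qed.

Lemma half_le (u t : nat) (e : int) :
  (((u%:Z - t%:Z + 1) %/ 2)%Z)%:~R - 1 < e%:~R :> rat ->
  u%:Z <= 2 * e + t%:Z.
Proof.
by rewrite -[_%:~R - 1]/(_%:~R - 1%:~R) -intrB ltr_int; lia.
Qed.

Lemma half_lt (u t : nat) (e : int) :
  e%:~R < (((u%:Z - t%:Z - 1) %/ 2)%Z)%:~R + 1 :> rat ->
  2 * e + t%:Z < u%:Z.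
Proof.
by rewrite -[_%:~R + 1]/(_%:~R + 1%:~R) -intrD ltr_int; lia.
Qed.

Lemma itv2 (lo w : int) : lo <= w <= lo + 1 -> w = lo \/ w = lo + 1.
Proof. lia. Qed.

Lemma itv3 (lo w : int) : lo <= w <= lo + 2 ->
  w = lo \/ w = lo + 1 \/ w = lo + 2.
Proof. lia. Qed.

Ltac divz_value := match goal with |- context [divz ?a ?b] =>
  let c := eval vm_compute in (divz a b) in change (divz a b) with c end.

(* In units of four macro cells: x is the ideal position of a bottom tooth, the
   i-th of its strip, which occupies [q, q + w]; the top tooth with ideal position
   x - c * a is the j-th of its strip, which occupies [q + e, q + e + w']. *)
Lemma compare_teeth (c : bool) (a x : rat) (i j : nat) (q w e w' : int) :
  1 <= a < 3 -> (i < 2)%N -> (j < top_count a)%N ->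
  floor_of (x - i%:R * a) q ->
  floor_of (x + (2 - i%:R) * a) (q + w) ->
  floor_of (x - (j%:R + c%:R) * a) (q + e) ->
  floor_of (x + ((top_count a)%:R - (j%:R + c%:R)) * a) (q + e + w') ->
  let bottom := (nth 0%N (bottoms (above_piece a w)) i)%:Z in
  let top := 2 * e + (nth 0%N (tops (gap_piece a w')) j)%:Z in
  if c then top < bottom else bottom <= top.
Proof.
rewrite /floor_of !intrD /above_piece /gap_piece /top_count => /andP[a1 a3] i2.
have [a2|a2] := leP 2 a; have [a32|a32] := ltP a (3 / 2).
- by exfalso; lra.
- move=> j1 /andP[Hq Hq'] /andP[Hw Hw'] /andP[He He'] /andP[Hv Hv'].
  case: j j1 He He' Hv Hv' => [|//] _ He He' Hv Hv'.
  (* Both widths are differences of floors of points at distances [2 * a] and [a], so few values are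
     possible. For each of them [half_lt] or [half_le] leaves a linear bound on [e]. The other cases
     go likewise. *)
  have /itv3 Ew : 4 <= w <= 4 + 2 by apply: int_itv; lra.
  have /itv2 Ew' : 2 <= w' <= 2 + 1 by apply: int_itv; lra.
  case: i i2 Hq Hq' Hw Hw' => [|[|//]] _ Hq Hq' Hw Hw';
  case: Ew => [|[|]] Ew; case: Ew' => Ew'; subst w w' => /=;
  (case: c He He' Hv Hv' => /= He He' Hv Hv';
   [apply: half_lt | apply: half_le]; divz_value; lra).
- move=> j3 /andP[Hq Hq'] /andP[Hw Hw'] /andP[He He'] /andP[Hv Hv'].
  have /itv2 Ew : 2 <= w <= 2 + 1 by apply: int_itv; lra.
  have /itv3 Ew' : 3 <= w' <= 3 + 2 by apply: int_itv; lra.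
  case: i i2 Hq Hq' Hw Hw' => [|[|//]] _ Hq Hq' Hw Hw';
  case: j j3 He He' Hv Hv' => [|[|[|//]]] _ He He' Hv Hv';
  case: Ew => Ew; case: Ew' => [|[|]] Ew'; subst w w' => /=;
  (case: c He He' Hv Hv' => /= He He' Hv Hv';
   [apply: half_lt | apply: half_le]; divz_value; lra).
move=> j3 /andP[Hq Hq'] /andP[Hw Hw'] /andP[He He'] /andP[Hv Hv'].
have /itv2 Ew : 3 <= w <= 3 + 1 by apply: int_itv; lra.
have /itv3 Ew' : 4 <= w' <= 4 + 2 by apply: int_itv; lra.
case: i i2 Hq Hq' Hw Hw' => [|[|//]] _ Hq Hq' Hw Hw';
case: j j3 He He' Hv Hv' => [|[|[|//]]] _ He He' Hv Hv';
case: Ew => Ew; case: Ew' => [|[|]] Ew'; subst w w' => /=;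
(case: c He He' Hv Hv' => /= He He' Hv Hv';
 [apply: half_lt | apply: half_le]; divz_value; lra).
Qed.

Lemma bottom_le_top (a x : rat) (i j : nat) (q w e w' : int) :
  1 <= a < 3 -> (i < 2)%N -> (j < top_count a)%N ->
  floor_of (x - i%:R * a) q ->
  floor_of (x + (2 - i%:R) * a) (q + w) ->
  floor_of (x - j%:R * a) (q + e) ->
  floor_of (x + ((top_count a)%:R - j%:R) * a) (q + e + w') ->
  (nth 0%N (bottoms (above_piece a w)) i)%:Z <=
    2 * e + (nth 0%N (tops (gap_piece a w')) j)%:Z.
Proof.
by move=> Ha i2 jk; rewrite -[j%:R]addr0; apply: (@compare_teeth false).
Qed.

Lemma top_lt_next_bottom (a x : rat) (i j : nat) (q w e w' : int) :
  1 <= a < 3 -> (i < 2)%N -> (j < top_count a)%N ->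
  floor_of (x - i%:R * a) q ->
  floor_of (x + (2 - i%:R) * a) (q + w) ->
  floor_of (x - (j%:R + 1) * a) (q + e) ->
  floor_of (x + ((top_count a)%:R - (j%:R + 1)) * a) (q + e + w') ->
  2 * e + (nth 0%N (tops (gap_piece a w')) j)%:Z <
    (nth 0%N (bottoms (above_piece a w)) i)%:Z.
Proof. exact: (@compare_teeth true). Qed.

(** * A tiling *)

Section Increasing.

Variable s : int -> int.
Hypothesis s_incr : forall l, s l < s (l + 1).

Lemma incr_add (l : int) (n : nat) : s l + n%:Z <= s (l + n%:Z).
Proof.
elim: n => [|n IH]; first by rewrite !addr0.
have := s_incr (l + n%:Z); rewrite (_ : l + n%:Z + 1 = l + n.+1%:Z); lia.
Qed.

Lemma incr_locate (x : int) : exists l, s l <= x < s (l + 1).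
Proof.
have step (n : nat) (l : int) :
    s l <= x < s (l + n%:Z) -> exists l', s l' <= x < s (l' + 1).
  elim: n => [|n IH] H; first by move: H; rewrite addr0; lia.
  have [Hx|Hx] := ltP x (s (l + n%:Z)); first by apply: IH; lia.
  exists (l + n%:Z); rewrite Hx (_ : _ + 1 = l + n.+1%:Z); lia.
pose N := (`|x|%N + `|s 0|%N).+1%N.
apply: (step (N + N)%N (- N%:Z)).
have H1 := incr_add (- N%:Z) N; have H2 := incr_add 0 N.
rewrite addNr in H1; rewrite add0r in H2.
rewrite (_ : - N%:Z + (N + N)%N%:Z = N%:Z); last by lia.
have : `|x| + `|s 0| < N%:Z by rewrite /N; lia.
by move: (s (- N%:Z)) (s N%:Z) (s 0) H1 H2 => a b c; clear; lia.
Qed.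

Lemma incr_unique (x l l' : int) :
  s l <= x < s (l + 1) -> s l' <= x < s (l' + 1) -> l = l'.
Proof.
have aux (u v : int) : u < v -> s u <= x < s (u + 1) ->
    s v <= x < s (v + 1) -> False.
  move=> uv Hu Hv; have := incr_add (u + 1) `|(v - u - 1)%R|%N.
  rewrite (_ : u + 1 + _ = v); lia.
by move=> H H'; case: (ltgtP l l') => // ll'; [have := aux _ _ ll' H H' |
  have := aux _ _ ll' H' H].
Qed.

End Increasing.

(** * Mean distances of teeth and positions of strips *)

Definition next_gap (a : rat) : rat := if 2 <= a then a / 2 else 3 / 2 * a.
Definition prev_gap (a : rat) : rat := if a < 3 / 2 then 2 * a else 2 / 3 * a.

Definition gap (j : int) : rat :=
  match j with
  | Posz n => iter n next_gap 1
  | Negz n => iter n.+1 prev_gap 1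
  end.

Lemma gap_range (j : int) : 1 <= gap j < 3.
Proof.
have H1 a : 1 <= a < 3 -> 1 <= next_gap a < 3.
  by rewrite /next_gap => /andP[]; case: (leP 2 a) => ? ? ?; apply/andP; split;
    lra.
have H2 a : 1 <= a < 3 -> 1 <= prev_gap a < 3.
  by rewrite /prev_gap => /andP[]; case: (ltP a (3/2)) => ? ? ?; apply/andP;
    split; lra.
by case: j => n; [elim: n => //= n /H1 | elim: n => [|n /H2] //; apply: H2].
Qed.

Lemma gap_next (j : int) : gap (j + 1) = next_gap (gap j).
Proof.
have K a : 1 <= a < 3 -> next_gap (prev_gap a) = a.
  move=> /andP[a1 a3]; rewrite /prev_gap; case: (ltP a (3 / 2)) => Ha;
    rewrite /next_gap; [case: leP | case: leP] => Hb; lra.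
case: j => [n|[|n]].
- by rewrite (_ : Posz n + 1 = n.+1) //; lia.
- by rewrite (_ : Negz 0 + 1 = 0) // [RHS]K.
rewrite (_ : Negz n.+1 + 1 = Negz n); last by lia.
by rewrite [RHS]K // (gap_range (Negz n)).
Qed.

(** Both sides are the ideal width of a strip of row [j], in units of four macro cells, measured by
    its top teeth and by its two bottom teeth. *)
Lemma gap_blocks (j : int) : (top_count (gap j))%:R * gap j = 2 * gap (j + 1).
Proof. by rewrite gap_next /top_count /next_gap; case: leP => _; lra. Qed.

(* In the row of strips at height - 2 * j the top teeth have mean distance 4 *
   gap j and the bottom teeth 4 * gap (j + 1). *)
Definition base (j n : int) : int :=
  Num.floor (n%:~R * ((top_count (gap j))%:R * gap j)).
Definition width (j n : int) : int := base j (n + 1) - base j n.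
Definition row_piece (j n : int) : nat := gap_piece (gap j) (width j n).
(** The summand [j] gives the teeth of consecutive strip rows opposite parities, as
    [phase_alternate] demands. *)
Definition start (j n : int) : int := j + 4 * base j n.

Lemma floor_ofP (x : rat) : floor_of x (Num.floor x).
Proof.
by have := floor_itv x; rewrite intrD.
Qed.

Lemma base_floor (j n : int) :
  floor_of (n%:~R * (2 * gap (j + 1))) (base j n).
Proof. by rewrite /base -gap_blocks; apply: floor_ofP. Qed.

(** [gap (j + 1)] is below 3/2 exactly when [gap j] is at least 2, so a strip gets the same index
    from its bottom teeth as from its top teeth: its width less 1 for kind 1, its width for kind
    2. *)
Lemma above_pieceE (j w : int) :
  above_piece (gap (j + 1)) w = gap_piece (gap j) w.
Proof.
rewrite gap_next /above_piece /gap_piece /next_gap; have /andP[g1 g3] :=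
  gap_range j.
case: (leP 2 (gap j)) => g2; case: ltP => // Hg; exfalso; lra.
Qed.

Lemma width_range (j n : int) :
  if 2 <= gap j then 2 <= width j n <= 3 else 3 <= width j n <= 6.
Proof.
have /andP[H1 H2] := base_floor j n; have /andP[H3 H4] := base_floor j (n + 1).
rewrite -gap_blocks intrD /top_count in H1 H2 H3 H4.
have /andP[g1 g3] := gap_range j.
have E : (base j (n + 1))%:~R = (base j n)%:~R + (width j n)%:~R :> rat.
  by rewrite -intrD; congr _%:~R; rewrite /width; lia.
rewrite E in H3 H4; move: H1 H2 H3 H4.
by case: (leP 2 (gap j)) => g2 H1 H2 H3 H4; apply: int_itv; lra.
Qed.

Lemma row_pieceP (j n : int) :
  [/\ row_piece j n \in iota 1 6, (piece_width (row_piece j n))%:Z = width j n,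
      piece_kind (row_piece j n) = (if 2 <= gap j then 1%N else 2%N),
      size (bottoms (row_piece j n)) = 2%N & size (tops (row_piece j n)) =
        top_count (gap j)].
Proof.
have := width_range j n; rewrite /row_piece /gap_piece /top_count.
move: (width j n) => w; case: (2 <= gap j) => /= H.
  by have [->|->] : w = 2 \/ w = 3 by clear -H; lia.
by have [->|[->|[->|->]]] : w = 3 \/ w = 4 \/ w = 5 \/ w = 6 by clear -H; lia.
Qed.

Definition row_tops (j : int) : nat := top_count (gap j).

Definition bottom_pos (j m : int) : int :=
  start j (m %/ 2)%Z + (2 * nth 0%N (bottoms (row_piece j (m %/ 2)%Z))
    `|(m %% 2)%Z|%N)%N%:Z.
Definition top_pos (j m : int) : int :=
  start j (m %/ row_tops j)%Z +
  (2 * nth 0%N (tops (row_piece j (m %/ row_tops j)%Z))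
    `|(m %% row_tops j)%Z|%N)%N%:Z.

Lemma start_next (j n : int) :
  start j (n + 1) = start j n + 4 * (piece_width (row_piece j n))%:Z.
Proof. by have [_ -> _ _ _] := row_pieceP j n; rewrite /start /width; lia. Qed.

Lemma start_incr (j n : int) : start j n < start j (n + 1).
Proof.
rewrite start_next; have [H _ _ _ _] := row_pieceP j n.
have : (0 < piece_width (row_piece j n))%N by move: H;
  apply/allP: (row_piece j n).
lia.
Qed.

Lemma row_tops_cases (j : int) : row_tops j = 1%N \/ row_tops j = 3%N.
Proof. by rewrite /row_tops /top_count; case: ifP; [left | right]. Qed.

Lemma int_natmod (m : int) (d : nat) : (0 < d)%N ->
  exists2 i : nat, (i < d)%N & m = (m %/ d)%Z * d%:Z + i%:Z /\ `|(m %% d)%Z|%N =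
    i.
Proof.
move=> d0; exists `|(m %% d)%Z|%N; first by lia.
by split=> //; rewrite {1}(divz_eq m d); lia.
Qed.

(** Bottom tooth [m] of row [j] and top tooth [m] of row [j + 1] have the same ideal position
    [m * a], where [compare_teeth] applies. The shift by 1 between the two values of [start] makes
    the weak inequality strict. *)
Lemma interleave (j m : int) :
  bottom_pos j m < top_pos (j + 1) m /\
    top_pos (j + 1) m < bottom_pos j (m + 1).
Proof.
set a := gap (j + 1); set x := m%:~R * a.
have Ha : 1 <= a < 3 := gap_range (j + 1).
have k0 : (0 < row_tops (j + 1))%N by case: (row_tops_cases (j + 1)) => ->.
have [i i2 [Ei Ei']] := int_natmod m (isT : (0 < 2)%N).
have [t tk [Et Et']] := int_natmod m k0.
have [i1 i12 [Ei1 Ei1']] := int_natmod (m + 1) (isT : (0 < 2)%N).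
rewrite /bottom_pos /top_pos Ei' Et' Ei1'.
set n := (m %/ 2)%Z in Ei *; set n1 := ((m + 1) %/ 2)%Z in Ei1 *.
set r := (m %/ row_tops (j + 1))%Z in Et *.
have cast2 (u v : int) (c e : nat) : u = v * c%:Z + e%:Z ->
    v%:~R * (c%:R * a) = (u%:~R - e%:R) * a :> rat.
  by move=> ->; rewrite intrD intrM -!pmulrn; ring.
have Fb (u v : int) (e : nat) : u = v * 2%:Z + e%:Z ->
    floor_of ((u%:~R - e%:R) * a) (base j v) /\
    floor_of ((u%:~R + (2 - e%:R)) * a) (base j v + width j v).
  move=> E; have H := base_floor j v; have H' := base_floor j (v + 1).
  rewrite -/a (cast2 _ _ 2%N _ E) in H.
  split=> //; rewrite /width [base j v + _]addrC subrK.
  have E' : u + 2%:Z = (v + 1) * 2%:Z + e%:Z by rewrite E; lia.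
  rewrite -/a (cast2 _ _ 2%N _ E') in H'.
  by move: H'; rewrite intrD -addrA.
have [B1 B2] := Fb _ _ _ Ei; have [N1 N2] := Fb _ _ _ Ei1.
have T1 : floor_of ((m%:~R - t%:R) * a) (base (j + 1) r).
  by rewrite -(cast2 _ _ _ _ Et); apply: floor_ofP.
have T2 : floor_of ((m%:~R + ((row_tops (j + 1))%:R - t%:R)) * a)
    (base (j + 1) r + width (j + 1) r).
  have E' : m + (row_tops (j + 1))%:Z = (r + 1) * (row_tops (j + 1))%:Z + t%:Z.
    by rewrite mulrDl mul1r addrAC -Et.
  rewrite /width [base (j + 1) r + _]addrC subrK addrA
    -[(row_tops _)%:R]/((row_tops (j+1))%:Z%:~R).
  by rewrite -intrD -(cast2 _ _ _ _ E'); apply: floor_ofP.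
split.
  have := @bottom_le_top a x i t (base j n) (width j n)
    (base (j + 1) r - base j n) (width (j + 1) r) Ha i2 tk.
  rewrite [base j n + (base (j + 1) r - _)]addrC subrK -!mulrDl -!mulrBl.
  move=> /(_ B1 B2 T1 T2); rewrite above_pieceE -/(row_piece j n)
    -/(row_piece (j + 1) r).
  rewrite /start; lia.
(* Now the reference point is the ideal position [x + a] of bottom tooth [m + 1]; the top tooth lies
   one [a] before it. *)
have := @top_lt_next_bottom a (x + a) i1 t (base j n1) (width j n1)
  (base (j + 1) r - base j n1) (width (j + 1) r) Ha i12 tk.
rewrite [base j n1 + (base (j + 1) r - _)]addrC subrK.
rewrite (_ : x + a = (m + 1)%:~R * a); last by rewrite /x intrD mulrDl mul1r.
rewrite -!mulrDl -!mulrBl => /(_ N1 N2).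
have -> : (m + 1)%:~R - (t%:R + 1) = m%:~R - t%:R :> rat by rewrite intrD; ring.
have -> : (m + 1)%:~R + ((top_count a)%:R - (t%:R + 1)) =
  m%:~R + ((row_tops (j + 1))%:R - t%:R) :> rat by rewrite intrD /row_tops -/a;
    ring.
move=> /(_ T1 T2); rewrite above_pieceE -/(row_piece j n1)
  -/(row_piece (j + 1) r).
rewrite /start; lia.
Qed.

(** * The teeth of a spacer row and the model tiling *)

Definition tooth (j l : int) : int :=
  if (l %% 2)%Z == 0 then bottom_pos j (l %/ 2)%Z else top_pos (j + 1)
    (l %/ 2)%Z.

Lemma tooth_incr (j l : int) : tooth j l < tooth j (l + 1).
Proof.
have [H1 H2] := interleave j (l %/ 2)%Z; rewrite /tooth.
case: eqP => H; case: eqP => H' //; try by exfalso; lia.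
  by rewrite (_ : ((l + 1) %/ 2)%Z = (l %/ 2)%Z) //; lia.
by rewrite (_ : ((l + 1) %/ 2)%Z = (l %/ 2)%Z + 1) //; lia.
Qed.

(** Consecutive teeth are thus at odd distance, and the even number of macro cells between them can
    be filled by dominoes. *)
Lemma tooth_parity (j l : int) : exists c, tooth j l = j + l + 2 * c.
Proof.
rewrite /tooth /bottom_pos /top_pos /start; case: eqP => H.
  set b := base _ _; set u := nth _ _ _.
  exists (2 * b + u%:Z - (l %/ 2)%Z); rewrite PoszM; lia.
set b := base _ _; set u := nth _ _ _.
exists (2 * b + u%:Z - (l %/ 2)%Z); rewrite PoszM; lia.
Qed.

Definition strip_pos (j n : int) : cell := (start j n, - (2 * j) - 1).

(** Strips of row [j] lie at height [- (2 * j)], one above the origin of their patch. Dominoes start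
    at odd distance from the tooth on their left because the tooth itself takes distance 0. *)
Definition model (i : 'I_7) : set cell := fun v =>
  (exists j n, i = row_piece j n :> nat /\ v = strip_pos j n) \/
  (i = 0%N :> nat /\ exists j l x, v = (x, - (2 * j) - 1) /\
    (tooth j l < x < tooth j (l + 1)) /\ odd `|(x - tooth j l)%R|%N).

Definition strip_owner (j n : int) : 'I_7 * cell :=
  (inord (row_piece j n), strip_pos j n).
Definition tooth_owner (j l : int) : 'I_7 * cell :=
  if (l %% 2)%Z == 0 then strip_owner j ((l %/ 2)%Z %/ 2)%Z
  else strip_owner (j + 1) ((l %/ 2)%Z %/ row_tops (j + 1))%Z.
Definition gap_owner (j l x : int) : 'I_7 * cell :=
  if x == tooth j l then tooth_owner j l else
  (ord0, (if odd `|(x - tooth j l)%R|%N then x else x - 1, - (2 * j) - 1)).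

Lemma row_piece_lt (j n : int) : (row_piece j n < 7)%N.
Proof. by have [H _ _ _ _] := row_pieceP j n; rewrite mem_iota in H; lia. Qed.

Lemma strip_ownerE (j n : int) (i : 'I_7) : i = row_piece j n :> nat ->
  (i, strip_pos j n) = strip_owner j n.
Proof.
move=> Hi; rewrite /strip_owner; congr pair; apply: val_inj => /=.
by rewrite inordK // row_piece_lt.
Qed.

Lemma model_strip (j n : int) : model (strip_owner j n).1 (strip_owner j n).2.
Proof. by left; exists j, n; rewrite /= inordK ?row_piece_lt. Qed.

Lemma mem_patch_strip (j n : int) (u : cell) : u \in patch (row_piece j n) <->
  [\/ u.2 = 1 /\ 0 <= u.1 < start j (n + 1) - start j n,
      u.2 = 0 /\ exists2 s, (s < 2)%N &
        u.1 = (2 * nth 0%N (bottoms (row_piece j n)) s)%N%:Z |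
      u.2 = 2 /\ exists2 s, (s < row_tops j)%N &
        u.1 = (2 * nth 0%N (tops (row_piece j n)) s)%N%:Z].
Proof.
have [Hi Hl _ Hb Ht] := row_pieceP j n.
rewrite start_next addrAC subrr add0r /row_tops -Ht.
have -> : patch (row_piece j n) =
  [seq (l%:Z, 1) | l <- iota 0 (4 * piece_width (row_piece j n))%N] ++
  [seq ((2 * u)%N%:Z, 0) | u <- bottoms (row_piece j n)] ++
  [seq ((2 * t)%N%:Z, 2) | t <- tops (row_piece j n)].
  by rewrite /patch; case: eqP => // E; rewrite E in Hi.
rewrite !mem_cat; split.
  case/or3P => /mapP[l H ->] /=.
  - by constructor 1; split=> //; move: H; rewrite mem_iota; lia.
  - constructor 2; split=> //; exists (index l (bottoms (row_piece j n))).
      by rewrite -Hb index_mem.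
    by rewrite nth_index.
  - constructor 3; split=> //; exists (index l (tops (row_piece j n))).
      by rewrite index_mem.
    by rewrite nth_index.
case: u => x y; case=> /= -[-> H]; apply/or3P.
- constructor 1; apply/mapP; exists `|x|%N; rewrite ?mem_iota; first by lia.
  by congr pair; lia.
- case: H => s Hs ->; constructor 2; apply/mapP.
  by exists (nth 0%N (bottoms (row_piece j n)) s); rewrite ?mem_nth ?Hb.
- case: H => s Hs ->; constructor 3; apply/mapP.
  by exists (nth 0%N (tops (row_piece j n)) s); rewrite ?mem_nth.
Qed.

Lemma even_row_owner (i : 'I_7) (v m : cell) (j : int) :
  model i v -> m - v \in patch i -> m.2 = - (2 * j) ->
  exists2 n, start j n <= m.1 < start j (n + 1) & (i, v) = strip_owner j n.
Proof.
case: m => x y; case=> [[j' [n [Hi ->]]]|[Hi [j' [l [x0 [-> _]]]]]].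
  rewrite Hi => /mem_patch_strip[] /= [E H] Ey.
  - have Ej : j' = j by lia.
    by subst j'; exists n; [lia | apply: strip_ownerE].
  - by exfalso; lia.
  - by exfalso; lia.
rewrite Hi patch_domino !xpair_eqE /= => H Ey; exfalso; lia.
Qed.

Lemma tooth_bottom (j n : int) (s : nat) : (s < 2)%N ->
  let l := (n * 2 + s%:Z) * 2 in
  tooth j l = start j n + (2 * nth 0%N (bottoms (row_piece j n)) s)%N%:Z /\
  tooth_owner j l = strip_owner j n.
Proof.
move=> Hs l; have E : (l %/ 2)%Z = n * 2 + s%:Z by rewrite /l; lia.
have E' : ((n * 2 + s%:Z) %/ 2)%Z = n by lia.
have Es : `|((n * 2 + s%:Z) %% 2)%Z|%N = s by lia.
have l0 : (l %% 2)%Z == 0 by rewrite /l; lia.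
by rewrite /tooth /tooth_owner l0 E /bottom_pos E' Es.
Qed.

Lemma tooth_top (j n : int) (s : nat) : (s < row_tops (j + 1))%N ->
  let l := (n * (row_tops (j + 1))%:Z + s%:Z) * 2 + 1 in
  tooth j l = start (j + 1) n +
    (2 * nth 0%N (tops (row_piece (j + 1) n)) s)%N%:Z /\
  tooth_owner j l = strip_owner (j + 1) n.
Proof.
move=> Hs l.
have E : (l %/ 2)%Z = n * (row_tops (j + 1))%:Z + s%:Z by rewrite /l; lia.
have l1 : ((l %% 2)%Z == 0) = false by rewrite /l; lia.
have [E' Es] : (((l %/ 2)%Z %/ row_tops (j + 1))%Z = n) /\
    `|((l %/ 2)%Z %% row_tops (j + 1))%Z|%N = s.
  by rewrite E; case: (row_tops_cases (j + 1)) Hs => -> Hs; lia.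
by rewrite /tooth /tooth_owner l1 /top_pos E' Es.
Qed.

Lemma odd_row_owner (i : 'I_7) (v m : cell) (j : int) :
  model i v -> m - v \in patch i -> m.2 = - (2 * j) - 1 ->
  exists2 l, tooth j l <= m.1 < tooth j (l + 1) & (i, v) = gap_owner j l m.1.
Proof.
case: m => x y; case=> [[j' [n [Hi ->]]]|[Hi [j' [l [x0 [-> [Hx Hodd]]]]]]].
  rewrite Hi => /mem_patch_strip[] /= [E H] Ey.
  - by exfalso; lia.
  - have Ej : j' = j by lia.
    subst j'; case: H => s Hs Ex; have [Et Eo] := tooth_bottom j n Hs.
    move: Et Eo; set l := (_ + _) * 2 => Et Eo; exists l.
      by have := tooth_incr j l; lia.
    by rewrite /gap_owner (_ : x == _) ?Eo; [apply: strip_ownerE | lia].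
  - have Ej : j' = j + 1 by lia.
    subst j'; case: H => s Hs Ex; have [Et Eo] := tooth_top n Hs.
    move: Et Eo; set l := _ * 2 + 1 => Et Eo; exists l.
      by have := tooth_incr j l; lia.
    by rewrite /gap_owner (_ : x == _) ?Eo; [apply: strip_ownerE | lia].
rewrite Hi patch_domino !xpair_eqE /= => H Ey.
have Ej : j' = j by lia.
subst j'; have [c Ec] := tooth_parity j l; have [c' Ec'] :=
  tooth_parity j (l + 1).
exists l; first by lia.
rewrite /gap_owner (_ : (x == _) = false); last by lia.
congr pair; first exact: val_inj.
have [E|E] : x = x0 \/ x = x0 + 1 by lia.
  by rewrite E Hodd.
by rewrite E addrK (_ : odd _ = false) //; lia.
Qed.

Lemma strip_owner_in (j n x : int) : start j n <= x < start j (n + 1) ->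
  (x, - (2 * j)) - (strip_owner j n).2 \in patch (strip_owner j n).1.
Proof.
move=> H; rewrite /= inordK ?row_piece_lt //; apply/mem_patch_strip;
  constructor 1.
by rewrite /strip_pos /=; lia.
Qed.

Lemma gap_owner_in (j l x : int) : tooth j l <= x < tooth j (l + 1) ->
  model (gap_owner j l x).1 (gap_owner j l x).2 /\
  (x, - (2 * j) - 1) - (gap_owner j l x).2 \in patch (gap_owner j l x).1.
Proof.
move=> Hx; rewrite /gap_owner; case: eqP => [->|xl].
  have [s Hs El] : exists2 s : nat, (s < 2)%N & (l %% 2)%Z = s%:Z.
    by exists `|(l %% 2)%Z|%N; lia.
  case: s Hs El => [|[|//]] _ El.
    have [n [s Hs El']] : exists n, exists2 s : nat, (s < 2)%N &
        l = (n * 2 + s%:Z) * 2.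
      by exists ((l %/ 2)%Z %/ 2)%Z, `|((l %/ 2)%Z %% 2)%Z|%N; lia.
    have [Et Eo] := tooth_bottom j n Hs; rewrite -El' in Et Eo.
    rewrite Eo Et; split; first exact: model_strip.
    rewrite /= inordK ?row_piece_lt //; apply/mem_patch_strip; constructor 2.
    by rewrite /strip_pos /=; split; [lia | exists s; rewrite // addrC addKr].
  have [n [s Hs El']] : exists n, exists2 s : nat, (s < row_tops (j + 1))%N &
      l = (n * (row_tops (j + 1))%:Z + s%:Z) * 2 + 1.
    exists ((l %/ 2)%Z %/ row_tops (j + 1))%Z,
      `|((l %/ 2)%Z %% row_tops (j + 1))%Z|%N.
      by case: (row_tops_cases (j + 1)) => ->; lia.
    by case: (row_tops_cases (j + 1)) => ->; lia.
  have [Et Eo] := tooth_top n Hs; rewrite -El' in Et Eo.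
  rewrite Eo Et; split; first exact: model_strip.
  rewrite /= inordK ?row_piece_lt //; apply/mem_patch_strip; constructor 3.
  by rewrite /strip_pos /=; split; [lia | exists s; rewrite // addrC addKr].
split.
  right; split=> //=.
  exists j, l, (if odd `|(x - tooth j l)%R|%N then x else x - 1); split=> //.
  by case: ifP => Hodd; split=> //; lia.
by rewrite /= patch_domino !xpair_eqE /=; case: ifP => _; lia.
Qed.

Definition row_kind (y : int) : nat :=
  if (y %% 2)%Z == 0 then if 2 <= gap (- (y %/ 2)%Z) then 1%N else 2%N else 0%N.

Lemma row_kindE (i : 'I_7) (v u : cell) :
  model i v -> u \in patch i -> patch_kind i u = row_kind (v + u).2.
Proof.
case=> [[j [n [Hi ->]]]|[Hi [j [l [x [-> _]]]]]];
  rewrite Hi /row_kind /patch_kind /=.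
  have [_ _ -> _ _] := row_pieceP j n.
  move=> /mem_patch_strip[] [-> _] /=; case: eqP => // H; try by exfalso; lia.
  by rewrite (_ : - _ = j) //; lia.
rewrite patch_domino => /orP[] /eqP -> /=;
  by rewrite (_ : (_ == 0) = false) //; lia.
Qed.

(** Strip rows are cut at the values of [start j] and spacer rows at those of [tooth j]. Both
    sequences increase, so each macro cell lies in exactly one interval, which determines its
    owner. *)
Lemma macro_tiling_model : macro_tiling model.
Proof.
split=> [[x y]|i i' v v' u u' Ti Ti' Hu Hu' Hn].
  have [[j Ey]|[j Ey]] : (exists j, y = - (2 * j)) \/
    (exists j, y = - (2 * j) - 1).
    have [H|H] : (y %% 2)%Z = 0 \/ (y %% 2)%Z = 1 by lia.
      by left; exists (- (y %/ 2)%Z); lia.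
    by right; exists (- (y %/ 2)%Z - 1); lia.
  - have [n Hn] := incr_locate (start_incr j) x.
    exists (strip_owner j n); split=> [|[i v] [/= Ti Hv]].
      by split; [apply: model_strip | rewrite Ey; apply: strip_owner_in].
    have [n' /= Hn' ->] := even_row_owner Ti Hv Ey.
    by rewrite (incr_unique (start_incr j) Hn Hn').
  - have [l Hl] := incr_locate (tooth_incr j) x.
    exists (gap_owner j l x); split=> [|[i v] [/= Ti Hv]].
      by rewrite Ey; apply: gap_owner_in.
    have [l' /= Hl' ->] := odd_row_owner Ti Hv Ey.
    by rewrite (incr_unique (tooth_incr j) Hl Hl').
rewrite (row_kindE Ti Hu) (row_kindE Ti' Hu').
move: (v + u) (v' + u') Hn => [x y] [x' y'] Hn.
have HW z : spacer (row_kind z) = ((z %% 2)%Z != 0).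
  by rewrite /row_kind; case: ((z %% 2)%Z == 0) => //; case: ifP.
rewrite /fits !HW !inE !xpair_eqE /=.
have [E|E] := eqVneq (row_kind y) (row_kind y'); last first.
  rewrite andbF orFb.
  have Hy : y != y' by apply: contraNneq E => ->.
  lia.
rewrite andbT; lia.
Qed.

(** * Connectedness *)

Section Linked.

Variable A : {fset cell}.

(** Packs the membership proofs, so that paths are composed on plain cells instead of elements of
    the subtype. *)
Definition linked (x y : cell) : Prop :=
  exists (hx : x \in A) (hy : y \in A),
    connect (fun a b : A => adjacent (val a) (val b)) [` hx]%fset [` hy]%fset.

Lemma linked_step (x y : cell) :
  x \in A -> y \in A -> adjacent x y -> linked x y.
Proof. by move=> hx hy H; exists hx, hy; apply: connect1. Qed.

Lemma linked_refl (x : cell) : x \in A -> linked x x.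
Proof. by move=> hx; exists hx, hx; apply: connect0. Qed.

Lemma linked_sym (x y : cell) : linked x y -> linked y x.
Proof.
move=> [hx [hy H]]; exists hy, hx; rewrite sym_connect_sym // => a b.
by rewrite /adjacent !(distrC (val a).1) !(distrC (val a).2).
Qed.

Lemma linked_trans (x y z : cell) : linked x y -> linked y z -> linked x z.
Proof.
move=> [hx [hy H]] [hy' [hz H']]; exists hx, hz; apply: connect_trans H _.
by rewrite (bool_irrelevance hy hy').
Qed.

End Linked.

Definition hub : cell := (11, 11).

(* A step inside the shape of kind k; iterating it leads from any cell of the
   shape around the dents to the hub. *)
Definition to_hub (k : nat) (p : cell) : cell :=
  let up := p + (0, 1) in let right := p + (1, 0) in
  let down := p - (0, 1) in let left := p - (1, 0) in
  if p == hub then p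
  else if 12 <= p.1 then (if p.2 == 6 then up else left)
  else if 12 <= p.2 then (if p.1 == 6 then right else down)
  else if 8 <= p.2 then (if p.1 < 11 then right else up)
  else if (8 <= p.1) || (5 <= p.1) && (5 <= p.2) then up
  else if p.2 == 6 then (if in_shape k right then right else down)
  else if p.1 == 6 then (if in_shape k up then up else left)
  else if p.2 == 5 then right else up.

Definition to_base (i : nat) (u : cell) : cell :=
  if i == 0%N then (0, 0)
  else if u.2 == 0 then u + (0, 1)
  else if u.2 == 2 then u - (0, 1)
  else if u.1 == 0 then u else u - (1, 0).

(** [hub] is a fixed point of [to_hub], so 40 only has to bound the lengths of all the paths, which
    computation confirms. *)
Lemma to_hubP (k : nat) (p : cell) : (k < 3)%N -> in_shape k p ->
  [/\ in_shape k (to_hub k p), (to_hub k p == p) || adjacent p (to_hub k p)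
    & iter 40 (to_hub k) p = hub].
Proof.
pose Q k p := [&& in_shape k (to_hub k p),
  (to_hub k p == p) || adjacent p (to_hub k p) & iter 40 (to_hub k) p == hub].
move=> Hk Hp; have : Q k p by apply: (@shape_ind Q _ k p Hk Hp); vm_compute.
by case/and3P => H1 H2 /eqP H3.
Qed.

Lemma to_baseP (i : 'I_7) (u : cell) : u \in patch i ->
  [/\ to_base i u \in patch i, (to_base i u == u) || adjacent u (to_base i u)
    & iter 30 (to_base i) u = (0, (i != 0%N :> nat)%:Z)].
Proof.
pose Q i u := [&& to_base i u \in patch i,
  (to_base i u == u) || adjacent u (to_base i u)
  & iter 30 (to_base i) u == (0, (i != 0%N)%:Z)].
move=> Hu; have : Q i u by apply: (@patch_ind Q _ i u Hu); vm_compute.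
by case/and3P => H1 H2 /eqP H3.
Qed.

Lemma iter_linked (A : {fset cell}) (S : cell -> Prop)
    (next emb : cell -> cell) :
  (forall p, S p -> emb p \in A) ->
  (forall p, S p -> S (next p) /\
     (next p = p \/ linked A (emb p) (emb (next p)))) ->
  forall n p, S p -> linked A (emb p) (emb (iter n next p)).
Proof.
move=> emb_in step; elim=> [|n IH] p Sp; first exact/linked_refl/emb_in.
have [Sn Hn] := step p Sp; rewrite iterSr.
by case: Hn => [E|H]; [rewrite E; apply: IH | apply: linked_trans H (IH _ Sn)].
Qed.

Lemma piece_cell (i : 'I_7) (u p : cell) :
  u \in patch i -> in_shape (patch_kind i u) p -> scale u + p \in piece i.
Proof.
move=> Hu Hp; rewrite mem_piece; apply/piece_cellsP; exists u => //.
by rewrite addrC addKr.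
Qed.

Lemma linked_hub (i : 'I_7) (u p : cell) : u \in patch i ->
  in_shape (patch_kind i u) p ->
  linked (piece i) (scale u + p) (scale u + hub).
Proof.
move=> Hu Hp; have [_ _ <-] := to_hubP (patch_kind_lt i u) Hp.
apply: (iter_linked (S := in_shape (patch_kind i u))
  (emb := fun q => scale u + q)) => //.
  by move=> q Hq; apply: piece_cell.
move=> q Hq; have [H1 H2 _] := to_hubP (patch_kind_lt i u) Hq; split=> //.
case/orP: H2 => [/eqP|Hadj]; [by left | right].
apply: linked_step; try exact: piece_cell.
by move: Hadj; case: q (to_hub _ _) {Hq H1} => [x y] [x' y'];
  rewrite /adjacent /=; lia.
Qed.

(** Every shape contains [(11, 11)], [(0, 11)] and [(11, 0)]; the first touches the second in the
    right neighbour and the third in the upper one. *)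
Lemma linked_neighbours (i : 'I_7) (u u' : cell) :
  u \in patch i -> u' \in patch i -> adjacent u u' ->
  linked (piece i) (scale u + hub) (scale u' + hub).
Proof.
have half (v v' p q : cell) : v \in patch i -> v' \in patch i ->
    in_shape (patch_kind i v) p -> in_shape (patch_kind i v') q ->
      adjacent (scale v + p) (scale v' + q) ->
    linked (piece i) (scale v + hub) (scale v' + hub).
  move=> Hv Hv' Hp Hq H; apply: linked_trans (linked_hub Hv' Hq).
  apply: linked_trans (linked_sym (linked_hub Hv Hp)) _.
  by apply: linked_step H; apply: piece_cell.
have in_hub v : in_shape (patch_kind i v) hub by apply: in_shape_square;
  rewrite ?patch_kind_lt.
have in_left v : in_shape (patch_kind i v) (0, 11).
  by have := patch_kind_lt i v; move: (patch_kind i v); apply: kind_ind.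
have in_low v : in_shape (patch_kind i v) (11, 0).
  by have := patch_kind_lt i v; move: (patch_kind i v); apply: kind_ind.
move=> Hu Hu' adj.
have : [\/ u' = u + (1, 0), u = u' + (1, 0), u' = u + (0, 1) | u = u' + (0, 1)].
  move: adj; case: u u' {Hu Hu'} => [x y] [x' y']; rewrite /adjacent /= => H.
  have [E|[E|[E|E]]] : (x' = x + 1 /\ y' = y) \/ (x = x' + 1 /\ y' = y) \/
    (x' = x /\ y' = y + 1) \/ (x' = x /\ y = y' + 1) by lia.
  - by case: E => -> ->; constructor 1; congr pair; rewrite /= addr0.
  - by case: E => -> ->; constructor 2; congr pair; rewrite /= addr0.
  - by case: E => -> ->; constructor 3; congr pair; rewrite /= addr0.
  - by case: E => -> ->; constructor 4; congr pair; rewrite /= addr0.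
case=> E.
- apply: half Hu Hu' (in_hub _) (in_left _) _; rewrite E; clear.
  by case: u => x y; rewrite /adjacent /scale /=; lia.
- apply: linked_sym; apply: half Hu' Hu (in_hub _) (in_left _) _; rewrite E;
  clear.
  by case: u' => x y; rewrite /adjacent /scale /=; lia.
- apply: half Hu Hu' (in_hub _) (in_low _) _; rewrite E; clear.
  by case: u => x y; rewrite /adjacent /scale /=; lia.
- apply: linked_sym; apply: half Hu' Hu (in_hub _) (in_low _) _; rewrite E;
  clear.
  by case: u' => x y; rewrite /adjacent /scale /=; lia.
Qed.

(** The path goes to the hub of the macro cell of [c], then from hub to hub along [to_base]. *)
Lemma piece_connected (i : 'I_7) (c : cell) : c \in piece i ->
  linked (piece i) c (scale (0, (i != 0%N :> nat)%:Z) + hub).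
Proof.
rewrite mem_piece => /piece_cellsP[u Hu Hc].
have := linked_hub Hu Hc; rewrite addrC subrK => /linked_trans; apply.
have [_ _ <-] := to_baseP Hu.
apply: (iter_linked (S := fun v => v \in patch i)
  (emb := fun v => scale v + hub)) => //.
  by move=> v Hv; apply: piece_cell => //; apply: in_shape_square;
    rewrite ?patch_kind_lt.
move=> v Hv; have [H1 H2 _] := to_baseP Hv; split=> //.
by case/orP: H2 => [/eqP|Hadj]; [left | right; apply: linked_neighbours].
Qed.

Lemma piece_polyomino (i : 'I_7) : polyomino (piece i).
Proof.
split.
  apply/fset0Pn; exists (scale (0, (i != 0%N :> nat)%:Z) + hub).
  by apply: piece_cell (patch_base i) _; apply: in_shape_square;
    rewrite ?patch_kind_lt.
move=> [x hx] [y hy].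
have [hx' [hy' H]] := linked_trans (piece_connected hx)
  (linked_sym (piece_connected hy)).
by move: H; rewrite (bool_irrelevance hx' hx) (bool_irrelevance hy' hy).
Qed.

(** * Distinctness up to translation *)

Definition in_corner (A : {fset cell}) : Prop :=
  [/\ forall c, c \in A -> 0 <= c.1 /\ 0 <= c.2,
      exists2 c, c \in A & c.1 = 0 & exists2 c, c \in A & c.2 = 0].

(** Both sets have the lower left corner of their bounding box at the origin, which forces
    [v = 0]. *)
Lemma in_corner_translate (A B : {fset cell}) (v : cell) :
  in_corner A -> in_corner B ->
    [set` A]%classic = translate v [set` B]%classic ->
  A = B.
Proof.
move=> [posA [a Ha a0] [b Hb b0]] [posB [a' Ha' a0'] [b' Hb' b0']] E.
have Ec c : (c \in A) = (c - v \in B).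
  apply/idP/idP => H.
    have : [set` A]%classic c by [].
    by rewrite E => -[d /= Hd <-]; rewrite addrK.
  have : translate v [set` B]%classic c by exists (c - v) => //; rewrite subrK.
  by rewrite -E.
suff v0 : v = 0 by apply/fsetP => c; rewrite Ec v0 subr0.
rewrite -(addrK v a') -Ec in Ha'; rewrite -(addrK v b') -Ec in Hb'.
rewrite Ec in Ha; rewrite Ec in Hb.
have [A1 _] := posB _ Ha; have [_ B1] := posB _ Hb.
have [A2 _] := posA _ Ha'; have [_ B2] := posA _ Hb'.
move: a0 b0 a0' b0' A1 B1 A2 B2; clear.
case: a b a' b' v => [? ?] [? ?] [? ?] [? ?] [x y] /= -> -> -> -> A1 B1 A2 B2.
by congr pair; lia.
Qed.

Lemma piece_corner (i : 'I_7) : in_corner (piece i).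
Proof.
split.
- move=> c; rewrite mem_piece => /piece_cellsP[u Hu Hc].
  have [H1 H2 _ _] := patch_local Hu.
  have := in_shape_box (patch_kind_lt i u) Hc; rewrite mem_box.
  move: H2; rewrite !inE; case: c u {Hu Hc} H1 => [x y] [a b] /=.
  rewrite /scale /=; lia.
- exists (scale (0, (i != 0%N :> nat)%:Z) + (0, 11)) => //.
  apply: piece_cell (patch_base i) _.
  by have := patch_kind_lt i (0, (i != 0%N :> nat)%:Z); move: (patch_kind _ _);
    apply: kind_ind.
have [x Hx] : exists x : int, (x, 0) \in patch i.
  have [->|i0] := eqVneq (i : nat) 0%N; first by exists 0.
  have Hb : (0, 1) \in patch i by have := patch_base i; rewrite i0.
  by have [_ _ _ _ [b [_ [H _]]]] := patch_strip Hb erefl; exists b%:Z.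
exists (scale (x, 0) + (11, 0)) => //; apply: piece_cell Hx _.
by have := patch_kind_lt i (x, 0); move: (patch_kind _ _); apply: kind_ind.
Qed.

Lemma piece_distinct (i j : 'I_7) : i != j ->
  exists c, (c \in piece_cells i) != (c \in piece_cells j).
Proof.
pose mem i (c : cell) := has (fun u => in_shape (patch_kind i u) (c - scale u))
  (patch i).
have memE (k : nat) c : (c \in piece_cells k) = mem k c.
  apply/idP/idP => [/piece_cellsP[u H1 H2] | /hasP [u H1 H2]].
    by apply/hasP; exists u.
  by apply/piece_cellsP; exists u.
(* The first five cells are hubs of the last macro cell of strips of widths 2 to 6 and detect the
   width. [(146, 18)] is the right spur of a strip of kind 1 and width 3, separating pieces 2 and 3;
   [(11, 11)] lies in the domino. *)
pose tests : seq cell :=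
  [:: (95, 23); (143, 23); (191, 23); (239, 23); (287, 23); (146, 18);
    (11, 11)].
pose Q i j := (i != j) ==> has (fun c => mem i c != mem j c) tests.
have HQ : all (fun i => all (Q i) (iota 0 7)) (iota 0 7) by vm_compute.
have : Q i j.
  by apply: (allP (allP HQ i _) j); rewrite mem_iota ltn_ord.
move=> {HQ} /implyP Q_ij ij; have /hasP[c _ Hc] := Q_ij ij.
by exists c; move: Hc; rewrite -(memE i) -(memE j).
Qed.

Lemma piece_polyomino_set : polyomino_set piece.
Proof.
split; first exact: piece_polyomino.
move=> i j v ij /(in_corner_translate (piece_corner i) (piece_corner j)) E.
have [c /eqP[]] := piece_distinct ij.
have Ec : (c \in piece i) = (c \in piece j) by rewrite E.
exact: etrans (esym (mem_piece i c)) (etrans Ec (mem_piece j c)).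
Qed.

Theorem corollary1 :
  exists P : 'I_7 -> {fset cell},
    polyomino_set P /\
    (exists T : 'I_7 -> set cell, tiling P T) /\
    (forall T : 'I_7 -> set cell, tiling P T -> ~ periodic T).
Proof.
exists piece; split; first exact: piece_polyomino_set.
split; first by eexists; apply: macro_tiling_tiling macro_tiling_model.
move=> T /tiling_macro_tiling [o [mt Hgrid]] /(macro_tiling_period mt Hgrid)
  [w w0 per].
exact: macro_tiling_aperiodic mt w0 per.
Qed.
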